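(* Let $K$ be a nonzero closed graded submodule of the free Hilbert module $H^2=H^2(\mathbb C^d)$ which is of infinite codimension in $H^2$. Then $\mathrm{rank}\,K=\infty$.
   Context: Let $d\ge1$, $A=\mathbb C[z_1,\dots,z_d]$. $H^2=H^2(\mathbb C^d)$ is the Hilbert space completion of $A$ in the inner product for which monomials are mutually orthogonal and $\|z^\alpha\|^2=\alpha!/|\alpha|!$ (the symmetric Fock space); equivalently, the reproducing kernel Hilbert space of holomorphic functions on the open unit ball $B_d$ with kernel $(1-\langle z,w\rangle)^{-1}$. It is an $A$-module under multiplication. A closed submodule $K\subseteq H^2$ is a closed subspace invariant under multiplication by $z_1,\dots,z_d$; it is graded if it is invariant under $(\Gamma_0(\lambda)f)(z)=f(\lambda z)$ for all $\lambda\in\mathbb C$ with $|\lambda|=1$. With $T_kf=z_kf$ ($f\in K$) regarded as operators on $K$, $\mathrm{rank}\,K$ is the dimension of the closure of the range of $\Delta=(\mathbf 1_K-T_1T_1^*-\dots-T_dT_d^* )^{1/2}$. *)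

(* Defs.v *)
From HB Require Import structures.
From mathcomp Require Import all_boot all_order all_algebra.
From mathcomp Require Import complex.
From mathcomp Require Import all_classical all_reals.
From mathcomp Require Import ereal topology normedtype sequences.
From mathcomp Require Import ring lra.

Set Implicit Arguments.
Unset Strict Implicit.
Unset Printing Implicit Defensive.
Import Order.TTheory GRing.Theory Num.Theory.
Import numFieldNormedType.Exports.
Local Open Scope classical_set_scope.
Local Open Scope ring_scope.
Local Open Scope complex_scope.

Section MultiIndex.
Variable d : nat.

Definition midx := {ffun 'I_d -> nat}.
Definition mdeg (a : midx) : nat := (\sum_i a i)%N.
Definition mfact (a : midx) : nat := (\prod_i (a i)`!)%N.
Definition minc (k : 'I_d) (a : midx) : midx := [ffun i => (a i + (i == k))%N].
Definition mdec (k : 'I_d) (a : midx) : midx := [ffun i => (a i - (i == k))%N].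

Lemma finite_mdeg n : finite_set [set a : midx | mdeg a = n].
Proof.
apply: (@sub_finite_set _ _
  ((fun b : {ffun 'I_d -> 'I_n.+1} => [ffun i => b i : nat] : midx) @` setT)).
  move=> a /= an; exists [ffun i => inord (a i)] => //.
  apply/ffunP => i; rewrite !ffunE inordK // ltnS -an /mdeg.
  by rewrite (bigD1 i) //= leq_addr.
exact/finite_image/finite_finset.
Qed.

Lemma mdecK k (a : midx) : (0 < a k)%N -> minc k (mdec k a) = a.
Proof.
move=> ak; apply/ffunP => i; rewrite !ffunE.
by case: eqP => [->|_]; rewrite ?subnK // subn0 addn0.
Qed.

Lemma mincK k : cancel (minc k) (mdec k).
Proof. by move=> a; apply/ffunP => i; rewrite !ffunE addnK. Qed.

Lemma mdeg_minc k a : mdeg (minc k a) = (mdeg a).+1.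
Proof.
rewrite /mdeg; under eq_bigr do rewrite ffunE.
rewrite big_split /= [X in (_ + X)%N](bigD1 k) //= eqxx.
by rewrite [X in (_ + (_ + X))%N]big1 ?addn0 ?addn1 // => i /negPf ->.
Qed.

Lemma mfact_minc k a : mfact (minc k a) = ((a k).+1 * mfact a)%N.
Proof.
rewrite /mfact (bigD1 k) //= [in RHS](bigD1 k) //= !ffunE eqxx addn1 factS.
rewrite mulnA; congr muln; apply: eq_bigr => i /negPf ik.
by rewrite ffunE ik addn0.
Qed.

End MultiIndex.

Section Coefficients.
Variables (R : realType) (d : nat).
Local Notation C := R[i].
Local Notation M := (midx d).
Implicit Types f g : M -> C.

Definition mweight (a : M) : R := (mfact a)%:R / (mdeg a)`!%:R.

Lemma mweight_gt0 a : 0 < mweight a.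
Proof.
by rewrite divr_gt0 // ltr0n ?fact_gt0 // prodn_gt0 // => i; rewrite fact_gt0.
Qed.

Lemma mweight_minc k a : mweight (minc k a) <= mweight a.
Proof.
rewrite /mweight mfact_minc mdeg_minc factS !natrM.
rewrite invfM mulrACA ler_piMl ?(ltW (mweight_gt0 a)) //.
rewrite ler_pdivrMr ?mul1r ?ltr0n // ler_nat ltnS /mdeg.
by rewrite (bigD1 k) //= leq_addr.
Qed.

(* The inner product of the homogeneous components of degree n of f and g. *)
Definition hdot (n : nat) f g : C :=
  \sum_(a \in [set a : M | mdeg a = n]) (f a * (g a)^* * (mweight a)%:C).

Definition square_summable f : Prop :=
  cvgn (series (fun n => complex.Re (hdot n f f))).

Let ms n : seq M := finmap.enum_fset (fset_set [set a : M | mdeg a = n]).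

Let msq (z : C) : R := complex.Re z ^+ 2 + complex.Im z ^+ 2.

Let msq_ge0 z : 0 <= msq z.
Proof. by rewrite addr_ge0 ?sqr_ge0. Qed.

Let msqM x y : msq (x * y) = msq x * msq y.
Proof. by case: x => a b; case: y => c e; rewrite /msq /=; ring. Qed.

Let msq_eq0 z : (msq z == 0) = (z == 0).
Proof.
by case: z => a b; rewrite /msq paddr_eq0 ?sqr_ge0 //= !sqrf_eq0 eq_complex.
Qed.

Let nrm2 n f : R := \sum_(a <- ms n) mweight a * msq (f a).

Let mulJ (z : C) : z * z^* = (msq z)%:C.
Proof.
case: z => a b; apply/eqP; rewrite eq_complex /msq /=.
by apply/andP; split; apply/eqP; ring.
Qed.

Let Re_hdot n f : complex.Re (hdot n f f) = nrm2 n f.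
Proof.
rewrite /hdot fsbig_finite /=; last exact: finite_mdeg.
rewrite (_ : \sum_(_ <- _) _ = (nrm2 n f)%:C) //.
rewrite /nrm2 rmorph_sum; apply: eq_bigr => a _ /=.
by rewrite mulJ mulrC -rmorphM.
Qed.

Let nrm2_ge0 n f : 0 <= nrm2 n f.
Proof.
by apply: sumr_ge0 => a _; rewrite mulr_ge0 ?msq_ge0 // ltW // mweight_gt0.
Qed.

Let S f N : R := series (fun n => complex.Re (hdot n f f)) N.

Let SE f N : S f N = \sum_(0 <= n < N) nrm2 n f.
Proof. by rewrite /S /series /=; apply: eq_bigr => n _; rewrite Re_hdot. Qed.

Let S_nd f : nondecreasing_seq (S f).
Proof.
apply/nondecreasing_seqP => N.
by rewrite !SE big_nat_recr //= lerDl nrm2_ge0.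
Qed.

Lemma square_summableP f B :
  (forall N, series (fun n => complex.Re (hdot n f f)) N <= B) ->
  square_summable f.
Proof.
move=> H; apply: nondecreasing_is_cvgn; first exact: S_nd.
by exists B => _ [N _ <-]; exact: H.
Qed.

Definition normsq f : R := limn (series (fun n => complex.Re (hdot n f f))).

Lemma normsq_ub f N : square_summable f ->
  series (fun n => complex.Re (hdot n f f)) N <= normsq f.
Proof. by move=> Sf; apply: nondecreasing_cvgn_le => //; exact: S_nd. Qed.

Lemma normsq_le f B : square_summable f ->
  (forall N, series (fun n => complex.Re (hdot n f f)) N <= B) ->
  normsq f <= B.
Proof. by move=> Sf H; apply: limr_le => //; exact: nearW. Qed.

Lemma normsq_ge0 f : square_summable f -> 0 <= normsq f.
Proof.
by move=> /(normsq_ub 0); apply: le_trans; rewrite /series /= big_geq.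
Qed.

Let msqD (t : R) (x y : C) : 0 < t ->
  msq (x + y) <= (1 + t) * msq x + (1 + t^-1) * msq y.
Proof.
move=> t0; case: x => a b; case: y => c e; rewrite /msq /= -subr_ge0.
rewrite (_ : _ - _ = t^-1 * ((t * a - c) ^+ 2 + (t * b - e) ^+ 2)).
  by rewrite mulr_ge0 ?invr_ge0 ?addr_ge0 ?sqr_ge0 // ltW.
have tn : t != 0 by rewrite gt_eqF.
by field.
Qed.

Let SD (t : R) f g N : 0 < t ->
  S (fun a => f a + g a) N <= (1 + t) * S f N + (1 + t^-1) * S g N.
Proof.
move=> t0; rewrite !SE !mulr_sumr -big_split /=; apply: ler_sum => n _.
rewrite !mulr_sumr -big_split /=; apply: ler_sum => a _.
rewrite [X in _ <= X + _]mulrCA [X in _ <= _ + X]mulrCA -mulrDr.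
by rewrite ler_wpM2l ?msqD // ltW ?mweight_gt0.
Qed.

Let SZ c f N : S (fun a => c * f a) N = msq c * S f N.
Proof.
rewrite !SE mulr_sumr; apply: eq_bigr => n _; rewrite mulr_sumr.
by apply: eq_bigr => a _; rewrite msqM mulrCA.
Qed.

Let normsqD_le (t : R) f g : 0 < t -> square_summable f -> square_summable g ->
  forall N, S (fun a => f a + g a) N
    <= (1 + t) * normsq f + (1 + t^-1) * normsq g.
Proof.
move=> t0 Sf Sg N; apply: (le_trans (SD _ _ _ t0)).
by apply: lerD; rewrite ler_wpM2l ?normsq_ub // addr_ge0 ?invr_ge0 // ltW.
Qed.

Lemma square_summableD f g : square_summable f -> square_summable g ->
  square_summable (fun a => f a + g a).
Proof. by move=> Sf Sg; exact: (square_summableP (normsqD_le ltr01 Sf Sg)). Qed.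

Lemma square_summableZ c f :
  square_summable f -> square_summable (fun a => c * f a).
Proof.
move=> Sf; apply: (@square_summableP _ (msq c * normsq f)) => N.
by rewrite [leLHS]SZ ler_wpM2l // normsq_ub.
Qed.

Lemma square_summable0 : square_summable (fun=> 0).
Proof.
apply: (@square_summableP _ 0) => N; rewrite [leLHS]SE big1 // => n _.
by rewrite /nrm2 big1 // => a _; rewrite /msq /= expr0n addr0 mulr0.
Qed.

Lemma normsqZ c f : square_summable f ->
  normsq (fun a => c * f a) =
  (complex.Re c ^+ 2 + complex.Im c ^+ 2) * normsq f.
Proof.
move=> Sf; rewrite /normsq -[X in _ = X * _]/(msq c).
rewrite (_ : series _ = msq c *: series (fun n => complex.Re (hdot n f f))).
  by rewrite limZr.
by apply/funext => N; exact: SZ.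
Qed.

Lemma normsq0_eq0 f : square_summable f -> normsq f = 0 -> forall a, f a = 0.
Proof.
move=> Sf f0 a; apply/eqP; rewrite -msq_eq0.
have ams : a \in ms (mdeg a).
  by rewrite /ms in_fset_set ?inE //; exact: finite_mdeg.
have : mweight a * msq (f a) <= 0.
  rewrite -f0; apply: le_trans (normsq_ub (mdeg a).+1 Sf).
  rewrite [leRHS]SE big_nat_recr //=.
  apply: ler_wpDl; first exact: sumr_ge0.
  rewrite /nrm2 (big_rem _ ams) /= lerDl sumr_ge0 // => b _.
  by rewrite mulr_ge0 ?msq_ge0 // ltW // mweight_gt0.
rewrite pmulr_rle0 ?mweight_gt0 // => h.
by rewrite eq_le h msq_ge0.
Qed.

Lemma sqrt_normsqD f g : square_summable f -> square_summable g ->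
  Num.sqrt (normsq (fun a => f a + g a)) <=
  Num.sqrt (normsq f) + Num.sqrt (normsq g).
Proof.
move=> Sf Sg.
have [f0|f0] := eqVneq (normsq f) 0.
  rewrite (_ : (fun a => _) = g) ?lerDr ?sqrtr_ge0 //.
  by apply/funext => a; rewrite normsq0_eq0 // add0r.
have [g0|g0] := eqVneq (normsq g) 0.
  rewrite (_ : (fun a => _) = f) ?lerDl ?sqrtr_ge0 //.
  by apply/funext => a; rewrite (normsq0_eq0 Sg) // addr0.
have {}f0 : 0 < Num.sqrt (normsq f).
  by rewrite sqrtr_gt0 lt_neqAle eq_sym f0 normsq_ge0.
have {}g0 : 0 < Num.sqrt (normsq g).
  by rewrite sqrtr_gt0 lt_neqAle eq_sym g0 normsq_ge0.
set x := Num.sqrt (normsq f) in f0 *; set y := Num.sqrt (normsq g) in g0 *.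
have -> : x + y = Num.sqrt ((x + y) ^+ 2).
  by rewrite sqrtr_sqr ger0_norm // addr_ge0 // ltW.
apply: ler_wsqrtr.
apply: normsq_le; first exact: square_summableD.
move=> N; apply: le_trans (normsqD_le (divr_gt0 g0 f0) Sf Sg N) _.
rewrite -[normsq f]sqr_sqrtr ?normsq_ge0 // -[normsq g]sqr_sqrtr ?normsq_ge0 //.
rewrite -/x -/y le_eqVlt; apply/orP; left; apply/eqP.
by field; rewrite !gt_eqF.
Qed.

(* The coefficients of z_k f. *)
Definition shift_coef (k : 'I_d) f : M -> C :=
  fun a => if a k == 0%N then 0 else f (mdec k a).

Lemma square_summable_shift k f :
  square_summable f -> square_summable (shift_coef k f).
Proof.
move=> Sf; have ms_uniq n : uniq (ms n) by exact: finmap.fset_uniq.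
have msE n a : (a \in ms n) = (mdeg a == n).
  rewrite /ms in_fset_set; last exact: finite_mdeg.
  by apply/idP/eqP; rewrite inE.
have nrm2S n : nrm2 n.+1 (shift_coef k f) <= nrm2 n f.
  have pms : perm_eq [seq a : M <- ms n.+1 | a k != 0%N] (map (minc k) (ms n)).
    apply: uniq_perm; rewrite ?filter_uniq ?map_inj_uniq //.
      exact: can_inj (mincK k).
    move=> a; rewrite mem_filter msE; apply/andP/mapP => [[ak /eqP an]|[b]].
      rewrite -lt0n in ak; exists (mdec k a); rewrite ?mdecK //.
      by rewrite msE -eqSS -(mdeg_minc k) mdecK // an.
    by rewrite msE => /eqP <- ->; rewrite mdeg_minc !ffunE eqxx addn1.
  rewrite /nrm2 (bigID (fun a : M => a k != 0%N)) /=.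
  rewrite [X in _ + X]big1 ?addr0; last first.
    move=> a; rewrite negbK /shift_coef => ->.
    by rewrite /msq /= expr0n addr0 mulr0.
  rewrite -big_filter (perm_big _ pms) big_map; apply: ler_sum => b _.
  rewrite /shift_coef mincK !ffunE eqxx addn1 /=.
  by rewrite ler_wpM2r ?mweight_minc.
apply: (@square_summableP _ (normsq f)) => -[|N].
  by rewrite /series /= big_geq // normsq_ge0.
apply: le_trans (normsq_ub N Sf); rewrite [leLHS]SE [leRHS]SE big_nat_recl //=.
rewrite [X in X + _](_ : _ = 0) ?add0r; first exact: ler_sum.
rewrite /nrm2 big1_seq // => a /andP[_]; rewrite msE => /eqP a0.
have ak : a k = 0%N.
  by apply/eqP; move/eqP: a0; rewrite /mdeg sum_nat_eq0 => /forallP/(_ k).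
by rewrite /shift_coef ak /msq /= expr0n addr0 mulr0.
Qed.

Lemma square_summable_rot (l : C) f : `|l| = 1 ->
  square_summable f -> square_summable (fun a => l ^+ mdeg a * f a).
Proof.
move=> l1 Sf; apply: (@square_summableP _ (normsq f)) => N.
apply: le_trans (normsq_ub N Sf); rewrite [leLHS]SE [leRHS]SE.
apply: ler_sum => n _; apply: ler_sum => a _.
suff -> : msq (l ^+ mdeg a * f a) = msq (f a) by [].
rewrite msqM (_ : msq _ = 1) ?mul1r //.
have : (msq (l ^+ mdeg a))%:C = `|l ^+ mdeg a| ^+ 2 by rewrite add_Re2_Im2.
by rewrite normrX l1 !expr1n => -[].
Qed.

End Coefficients.

(* The completion of C[z_1, ..., z_d], realized as the space of the power series
   \sum_a f_a z^a with \sum_a |f_a|^2 a!/|a|! finite, given by the f_a. *)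
Record H2 (R : realType) (d : nat) : Type := MkH2 {
  coef :> midx d -> R[i];
  coefP : `[< square_summable coef >] }.

Section Space.
Variables (R : realType) (d : nat).
Local Notation C := R[i].
Local Notation M := (midx d).
Local Notation H := (H2 R d).

Definition sqs : pred (M -> C) := fun f => `[< square_summable f >].
HB.instance Definition _ := [isSub of H for @coef R d].
HB.instance Definition _ := [Choice of H by <:].

Fact sqs_closed : GRing.subsemimod_closed sqs.
Proof.
split; first split.
- by apply/asboolP; exact: square_summable0.
- by move=> f g /asboolP Sf /asboolP Sg; apply/asboolP/square_summableD.
- by move=> c f /asboolP Sf; apply/asboolP/square_summableZ.
Qed.

HB.instance Definition _ :=
  GRing.SubChoice_isSubLmodule.Build C (M -> C) sqs H sqs_closed.

Lemma H2_summable (f : H) : square_summable f.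
Proof. exact/asboolP/coefP. Qed.

Definition dot (f g : H) : C :=
  limn (series (fun n => complex.Re (hdot n f g))) +i*
  limn (series (fun n => complex.Im (hdot n f g))).

Definition H2norm (f : H) : C := (Num.sqrt (complex.Re (dot f f)))%:C.

Lemma coefD (f g : H) : coef (f + g) = fun a => f a + g a.
Proof. by []. Qed.

Lemma coefZ (c : C) (f : H) : coef (c *: f) = fun a => c * f a.
Proof. by []. Qed.

Lemma H2normE (f : H) : H2norm f = (Num.sqrt (normsq f))%:C.
Proof. by []. Qed.

Fact H2normD (f g : H) : H2norm (f + g) <= H2norm f + H2norm g.
Proof.
rewrite !H2normE coefD -rmorphD lecR.
by apply: sqrt_normsqD; exact: H2_summable.
Qed.

Fact H2normZ (c : C) (f : H) : H2norm (c *: f) = `|c| * H2norm f.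
Proof.
rewrite !H2normE coefZ normc_def -rmorphM -sqrtrM ?addr_ge0 ?sqr_ge0 //.
by rewrite normsqZ //; exact: H2_summable.
Qed.

Fact H2norm0_eq0 (f : H) : H2norm f = 0 -> f = 0.
Proof.
move=> [/eqP]; rewrite sqrtr_eq0 => f0; apply: val_inj; apply/funext => a.
apply: normsq0_eq0; first exact: H2_summable.
apply/eqP.
by rewrite eq_le f0 normsq_ge0 //; exact: H2_summable.
Qed.

HB.instance Definition _ :=
  Lmodule_isNormed.Build C H H2normD H2normZ H2norm0_eq0.

Definition zmul (k : 'I_d) (f : H) : H :=
  MkH2 (asboolT (@square_summable_shift R d k f (@H2_summable f))).

(* The operator f(z) |-> f(l z) for a scalar l on the unit circle. *)
Definition rot (l : C) (l1 : `|l| = 1) (f : H) : H :=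
  MkH2 (asboolT (@square_summable_rot R d l f l1 (@H2_summable f))).

Definition closed_submodule (K : set H) : Prop :=
  [/\ closed K,
      K 0 /\ (forall (c : C) f g, K f -> K g -> K (c *: f + g)) &
      forall k f, K f -> K (zmul k f)].

Definition graded (K : set H) : Prop :=
  forall (l : C) (l1 : `|l| = 1) f, K f -> K (rot l1 f).

(* The dimension of the image in H / W of a linear subspace V: the supremum of
   the n for which n vectors of V are linearly independent modulo W. *)
Definition dim_mod (W V : set H) : \bar R :=
  ereal_sup [set n%:R%:E | n in [set n : nat | exists v : 'I_n -> H,
    (forall i, V (v i)) /\
    (forall c : 'I_n -> C, W (\sum_i c i *: v i) -> forall i, c i = 0)]].

Definition dim (V : set H) : \bar R := dim_mod [set 0] V.

Definition codim (K : set H) : \bar R := dim_mod K setT.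

(* A bounded operator on K is represented by a function on the whole space;
   only its values on K are constrained, and only these are ever used. *)
Definition operator_on (K : set H) (T : H -> H) : Prop :=
  [/\ forall f, K f -> K (T f),
      forall (c : C) f g, K f -> K g -> T (c *: f + g) = c *: T f + T g &
      exists B : C, forall f, K f -> `|T f| <= B * `|f|].

(* Existence (for T bounded, resp. S bounded and positive) and uniqueness on K
   of the operators chosen below are the classical theorems. *)
Definition is_adjoint (K : set H) (T S : H -> H) : Prop :=
  operator_on K S /\ forall f g, K f -> K g -> dot (T f) g = dot f (S g).

Definition adjoint (K : set H) (T : H -> H) : H -> H :=
  get [set S | is_adjoint K T S].

(* In the order of R[i], 0 <= z means that z is real and nonnegative. *)
Definition is_sqrt (K : set H) (S D : H -> H) : Prop :=
  [/\ operator_on K D,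
      forall f, K f -> 0 <= dot (D f) f &
      forall f, K f -> D (D f) = S f].

Definition op_sqrt (K : set H) (S : H -> H) : H -> H :=
  get [set D | is_sqrt K S D].

Definition defect (K : set H) : H -> H :=
  op_sqrt K (fun f => f - \sum_k zmul k (adjoint K (zmul k) f)).

Definition rank (K : set H) : \bar R := dim (closure (defect K @` K)).

End Space.

(* Main.v *)
(* Let P project onto K and, for the compressions T_k^* = P z_k^*, let S = 1
   - sum_k T_k T_k^*, so that Delta^2 = S on K. S preserves degrees, so
   finite rank means S = 0 on K_n for n >= n0. Since sum_k z_k z_k^* f = f
   for f homogeneous of positive degree, S u = 0 gives sum_k |P z_k^* u|^2 =
   |u|^2 = sum_k |z_k^* u|^2, hence z_k^* u in K. Dually, if g is
   homogeneous of degree n >= n0 and orthogonal to K, then so is every z_k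
   g. Infinite codimension provides such a g <> 0, and K <> 0 a homogeneous
   f <> 0 in K; the product f g then lies both in K and in its orthogonal
   complement, so it vanishes, which is absurd for nonzero polynomials. *)
Require Import Defs.
From mathcomp Require Import all_boot all_order all_algebra.
From mathcomp Require Import complex.
From mathcomp Require Import all_classical all_reals.
From mathcomp Require Import ereal topology normedtype sequences.
From mathcomp Require Import ring lra zify.
Import Order.TTheory GRing.Theory Num.Theory.
Import numFieldNormedType.Exports.
Local Open Scope classical_set_scope.
Local Open Scope ring_scope.

Set Implicit Arguments.
Unset Strict Implicit.
Unset Printing Implicit Defensive.

(** [adjoint] and [op_sqrt] are bare choices, so nothing is known about [rank] until the adjoints
    and the root have been constructed. This is why completeness, projections onto closed subspaces
    and square roots of 1 - A for self-adjoint contractions A are developed here. All estimates use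
    the real inner product Re<f, g>; on a complex subspace, orthogonality for it is the same as
    orthogonality for [dot]. Operators are extended to all of H^2, so K never has to become a space
    of its own. Infinite codimension enters through its contrapositive: if K contained every
    homogeneous element of high degree, only the finitely many monomials of low degree could be
    missing. *)

Section InnerProduct.
Local Open Scope complex_scope.
Variables (R : realType) (d : nat).
Local Notation C := R[i].
Local Notation M := (midx d).
Local Notation H := (H2 R d).
Implicit Types (f g h : H) (u v : M -> C).

Definition mseq n : seq M := finmap.enum_fset (fset_set [set a : M | mdeg a =
  n]).

Lemma mem_mseq n a : (a \in mseq n) = (mdeg a == n).
Proof.
rewrite /mseq in_fset_set; last exact: finite_mdeg.
by apply/idP/eqP; rewrite inE.
Qed.

Lemma mseq_uniq n : uniq (mseq n). Proof. exact: finmap.fset_uniq. Qed.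

(** The real part of x times the conjugate of y. The imaginary part is the same form at ['i * y], so
    one real symmetric form determines [dot]. *)
Definition rprod (x y : C) : R :=
  complex.Re x * complex.Re y + complex.Im x * complex.Im y.

Lemma rprod_ge0 x : 0 <= rprod x x.
Proof. by rewrite /rprod -!expr2 addr_ge0 ?sqr_ge0. Qed.

Lemma rprodE x : rprod x x = complex.Re (`|x| ^+ 2).
Proof. by rewrite -add_Re2_Im2 /rprod -!expr2. Qed.

Definition hrdot n u v : R :=
  \sum_(a <- mseq n) mweight R a * rprod (u a) (v a).

Lemma Re_hdot n u v : complex.Re (hdot n u v) = hrdot n u v.
Proof.
rewrite /hdot fsbig_finite /=; last exact: finite_mdeg.
rewrite /hrdot (big_morph _ (id1 := 0) (op1 := +%R)
  (fun x y => let: a +i* b := x in let: c +i* e := y in erefl) erefl) /=.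
apply: eq_bigr => a _; rewrite /rprod.
by case: (u a) (v a) => [? ?] [? ?] /=; ring.
Qed.

Lemma Im_hdot n u v :
  complex.Im (hdot n u v) = hrdot n u (fun a => 'i * v a).
Proof.
rewrite /hdot fsbig_finite /=; last exact: finite_mdeg.
rewrite /hrdot (big_morph _ (id1 := 0) (op1 := +%R)
  (fun x y => let: a +i* b := x in let: c +i* e := y in erefl) erefl) /=.
apply: eq_bigr => a _; rewrite /rprod.
by case: (u a) (v a) => [? ?] [? ?] /=; ring.
Qed.

Lemma hrdot_ge0 n u : 0 <= hrdot n u u.
Proof.
apply: sumr_ge0 => a _.
by rewrite mulr_ge0 ?rprod_ge0 // ltW // mweight_gt0.
Qed.

Lemma square_summableE u :
  square_summable u <-> cvgn (series (fun n => hrdot n u u)).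
Proof.
rewrite /square_summable.
by rewrite (_ : (fun n => _) = (fun n => hrdot n u u)) //; apply/funext => n;
  rewrite Re_hdot.
Qed.

Lemma normsqE u : normsq u = limn (series (fun n => hrdot n u u)).
Proof.
by rewrite /normsq; congr (limn (series _)); apply/funext => n; rewrite Re_hdot.
Qed.

(** Polarisation: membership in [H] gives convergence of the diagonal series only, and this identity
    passes it on to [hrdot n f g]. *)
Lemma hrdot_polar n u v :
  hrdot n u v = 4^-1 * (hrdot n (fun a => u a + v a) (fun a => u a + v a) -
    hrdot n (fun a => u a + (-1) * v a) (fun a => u a + (-1) * v a)).
Proof.
rewrite /hrdot -sumrB mulr_sumr; apply: eq_bigr => a _.
by rewrite /rprod; case: (u a) (v a) => [? ?] [? ?] /=; field.
Qed.

Lemma is_cvg_hrdot f g : cvgn (series (fun n => hrdot n f g)).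
Proof.
have Hcvg h := (@square_summableE h).1 (@H2_summable _ _ h).
rewrite (_ : (fun n => hrdot n f g) = (fun n => 4^-1 *
    (hrdot n (f + g) (f + g) - hrdot n (f + (-1) *: g) (f + (-1) *: g)))).
  by apply: is_cvg_seriesZ; exact: is_cvg_seriesB (Hcvg (f + g)) (Hcvg _).
by apply/funext => n; rewrite hrdot_polar.
Qed.

Definition rdot f g : R := limn (series (fun n => hrdot n f g)).

Lemma dotE f g : dot f g = rdot f g +i* rdot f ('i *: g).
Proof.
rewrite /dot /rdot; congr (_ +i* _); congr (limn (series _));
  by apply/funext => n; rewrite ?Re_hdot ?Im_hdot.
Qed.

Lemma rdotE f : rdot f f = normsq f.
Proof. by rewrite normsqE. Qed.

Lemma rdotC f g : rdot f g = rdot g f.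
Proof.
congr (limn (series _)); apply/funext => n; apply: eq_bigr => a _.
by rewrite /rprod mulrC [in RHS]mulrC ![complex.Re (f a) * _]mulrC
  ![complex.Im (f a) * _]mulrC.
Qed.

Lemma rdotDl f g h : rdot (f + g) h = rdot f h + rdot g h.
Proof.
rewrite /rdot -limD; try exact: is_cvg_hrdot.
rewrite -[X in _ = limn X](_ : series (fun n => hrdot n f h + hrdot n g h) = _).
  congr (limn (series _)); apply/funext => n; rewrite /hrdot -big_split.
  apply: eq_bigr => a _; rewrite Defs.coefD /rprod.
  by case: (f a) (g a) => [? ?] [? ?] /=; ring.
by rewrite seriesD.
Qed.

(** Only real scalars can be pulled out of the real form; a complex one moves to the other side as
    its conjugate. *)
Lemma rdotZJ (c : C) f g : rdot (c *: f) g = rdot f (c^* *: g).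
Proof.
congr (limn (series _)); apply/funext => n; apply: eq_bigr => a _.
rewrite !Defs.coefZ /rprod; congr (_ * _).
by case: c (f a) (g a) => [? ?] [? ?] [? ?] /=; ring.
Qed.

Lemma rdotZl (r : R) f g : rdot (r%:C *: f) g = r * rdot f g.
Proof.
rewrite /rdot -[RHS]/(r *: _) -limZl_tmp; last exact: is_cvg_hrdot.
rewrite -[X in _ = limn X](_ : series (r *: (fun n => hrdot n f g)) = _).
  congr (limn (series _)); apply/funext => n.
  rewrite -[RHS]/(r * hrdot n f g) /hrdot mulr_sumr.
  apply: eq_bigr => a _; rewrite Defs.coefZ /rprod.
  by case: (f a) (g a) => [? ?] [? ?] /=; ring.
by rewrite seriesZ.
Qed.

Lemma rdotZr (r : R) f g : rdot f (r%:C *: g) = r * rdot f g.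
Proof. by rewrite rdotC rdotZl rdotC. Qed.

Lemma rdotDr f g h : rdot f (g + h) = rdot f g + rdot f h.
Proof. by rewrite !(rdotC f) rdotDl. Qed.

Lemma rdotNl f g : rdot (- f) g = - rdot f g.
Proof.
by rewrite -scaleN1r -(rmorph1 (real_complex R)) -rmorphN rdotZl mulN1r.
Qed.

Lemma rdotNr f g : rdot f (- g) = - rdot f g.
Proof. by rewrite rdotC rdotNl rdotC. Qed.

Lemma rdotBl f g h : rdot (f - g) h = rdot f h - rdot g h.
Proof. by rewrite rdotDl rdotNl. Qed.

Lemma rdotBr f g h : rdot f (g - h) = rdot f g - rdot f h.
Proof. by rewrite rdotDr rdotNr. Qed.

Lemma rdot0l f : rdot 0 f = 0.
Proof. by rewrite -[0](subrr f) rdotBl subrr. Qed.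

Lemma rdot0r f : rdot f 0 = 0. Proof. by rewrite rdotC rdot0l. Qed.

Lemma rdot_suml (I : Type) (r : seq I) (F : I -> H) g :
  rdot (\sum_(i <- r) F i) g = \sum_(i <- r) rdot (F i) g.
Proof.
by apply: (big_morph (fun f => rdot f g)) => [? ?|]; rewrite ?rdotDl ?rdot0l.
Qed.

Lemma rdot_ge0 f : 0 <= rdot f f.
Proof. by rewrite rdotE normsq_ge0 //; exact: H2_summable. Qed.

Lemma rdot_eq0 f : rdot f f = 0 -> f = 0.
Proof.
rewrite rdotE => f0; apply: val_inj; apply/funext => a.
by apply: normsq0_eq0 f0 _; exact: H2_summable.
Qed.

Definition rnorm f : R := Num.sqrt (rdot f f).

Lemma normE f : `|f| = (rnorm f)%:C.
Proof. by rewrite /rnorm rdotE. Qed.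

Lemma rnorm_ge0 f : 0 <= rnorm f. Proof. exact: sqrtr_ge0. Qed.

Lemma sqr_rnorm f : rnorm f ^+ 2 = rdot f f.
Proof. by rewrite sqr_sqrtr // rdot_ge0. Qed.

Lemma rnormD f g : rnorm (f + g) <= rnorm f + rnorm g.
Proof. by have := ler_normD f g; rewrite !normE -rmorphD lecR. Qed.

Lemma rnormN f : rnorm (- f) = rnorm f.
Proof. by rewrite /rnorm rdotNl rdotNr opprK. Qed.

Lemma rnorm0 : rnorm 0 = 0. Proof. by rewrite /rnorm rdot0l sqrtr0. Qed.

Lemma rnorm_distC f g : rnorm (f - g) = rnorm (g - f).
Proof. by rewrite -rnormN opprB. Qed.

Lemma rnorm_triangle h f g : rnorm (f - g) <= rnorm (f - h) + rnorm (h - g).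
Proof. by apply: le_trans (rnormD _ _); rewrite addrA subrK. Qed.

Lemma rnorm_eq0 f : rnorm f = 0 -> f = 0.
Proof.
by move=> f0; apply: rdot_eq0; rewrite -sqr_rnorm f0 expr0n.
Qed.

Lemma rnorm_le f (r : R) : 0 <= r -> rdot f f <= r ^+ 2 -> rnorm f <= r.
Proof.
move=> r0 fr; rewrite -(ger0_norm r0) -sqrtr_sqr; exact: ler_wsqrtr.
Qed.

Lemma rnormZ (r : R) f : 0 <= r -> rnorm (r%:C *: f) = r * rnorm f.
Proof.
move=> r0; rewrite /rnorm rdotZl rdotZr mulrA -expr2 sqrtrM ?sqr_ge0 //.
by rewrite sqrtr_sqr ger0_norm.
Qed.

Lemma le0_small (x : R) : 0 <= x -> (forall e, 0 < e -> x <= e) -> x = 0.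
Proof.
move=> x0 xe; apply/eqP; rewrite eq_le x0 andbT.
by apply/ler_addgt0Pr => e e0; rewrite add0r xe.
Qed.

Lemma closed_approx (K : set H) f : closed K ->
  (forall e : R, 0 < e -> exists2 g, K g & rnorm (f - g) <= e) -> K f.
Proof.
move=> clK fK; apply: clK => B /nbhs_normP[e /= e0 eB].
have e'0 : 0 < complex.Re e by move: e0; rewrite ltcE => /andP[].
(* The norm is complex valued, so the radius [e] is a positive element of [R[i]]; half of its real
   part leaves room for the strict inequality of the ball. *)
have [g Kg fg] := fK _ (divr_gt0 e'0 (ltr0Sn _ 1)).
exists g; split=> //; apply: eB => /=.
rewrite normE (le_lt_trans (y := (complex.Re e / 2)%:C)) ?lecR //.
case: e e0 e'0 {fg} => a b; rewrite !ltcE /= => /andP[/eqP -> _] a0.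
by rewrite eqxx ltr_pdivrMr // mulr_natr mulr2n ltrDl.
Qed.

(** Makes evaluation of a coefficient continuous, so that Cauchy sequences converge
    coefficientwise. *)
Lemma rnorm_coef f a : mweight R a * rprod (f a) (f a) <= rdot f f.
Proof.
have Sf := @H2_summable _ _ f.
rewrite rdotE; apply: le_trans (normsq_ub (mdeg a).+1 Sf).
rewrite /series /= big_nat_recr //= Re_hdot.
apply: ler_wpDl.
  by apply: sumr_ge0 => n _; rewrite Re_hdot hrdot_ge0.
have am : a \in mseq (mdeg a) by rewrite mem_mseq.
rewrite /hrdot (big_rem _ am) /= lerDl sumr_ge0 // => b _.
by rewrite mulr_ge0 ?rprod_ge0 // ltW // mweight_gt0.
Qed.

Lemma square_summable_le u v : (forall a, `|u a| <= `|v a|) ->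
  square_summable v -> square_summable u /\ normsq u <= normsq v.
Proof.
move=> uv Sv.
have uvN N : series (fun n => complex.Re (hdot n u u)) N <= normsq v.
  apply: le_trans (normsq_ub N Sv); apply: ler_sum => n _.
  rewrite !Re_hdot; apply: ler_sum => a _.
  rewrite ler_wpM2l ?(ltW (mweight_gt0 _ _)) // !rprodE.
  have : `|u a| ^+ 2 <= `|v a| ^+ 2 by rewrite lerXn2r ?nnegrE.
  by rewrite lecE => /andP[].
have Su := square_summableP uvN.
by split=> //; exact: normsq_le.
Qed.

End InnerProduct.

(** * Completeness and orthogonal projections *)

Section HilbertSpace.
Local Open Scope complex_scope.
Variables (R : realType) (d : nat).
Local Notation C := R[i].
Local Notation H := (H2 R d).
Implicit Types (f g h p : H) (u : nat -> H) (K : set H) (A D : H -> H).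

Lemma cauchy_schwarz f g : `|rdot f g| <= rnorm f * rnorm g.
Proof.
have [->|g0] := eqVneq g 0; first by rewrite rdot0r normr0 rnorm0 mulr0.
have q0 : 0 < rdot g g.
  rewrite lt_neqAle rdot_ge0 andbT; apply: contra g0 => /eqP g0.
  by apply/eqP/rdot_eq0.
have := rdot_ge0 ((rdot g g)%:C *: f - (rdot f g)%:C *: g).
rewrite !rdotBl !rdotBr !rdotZl !rdotZr (rdotC g f).
rewrite (_ : _ - _ = rdot g g * (rdot f f * rdot g g - rdot f g ^+ 2));
  last by ring.
rewrite pmulr_rge0 // subr_ge0 -!sqr_rnorm -exprMn -(real_normK (num_real _)).
by rewrite ler_sqr ?nnegrE // mulr_ge0 ?rnorm_ge0.
Qed.

Definition cauchyH u := forall e : R, 0 < e ->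
  exists N, forall m n, (N <= m)%N -> (N <= n)%N -> rnorm (u m - u n) <= e.

Definition cvgH u f := forall e : R, 0 < e ->
  exists N, forall n, (N <= n)%N -> rnorm (u n - f) <= e.

Lemma real_cauchy_cvg (x : nat -> R) :
  (forall e : R, 0 < e -> exists N, forall m n, (N <= m)%N -> (N <= n)%N ->
    `|x m - x n| <= e) -> cvgn x.
Proof.
move=> xC; apply/cauchy_cvgP/cauchy_exP => e e0.
have [N xN] := xC _ (divr_gt0 e0 (ltr0Sn _ 1)).
exists (x N); exists N => // n /= Nn.
rewrite -ball_normE /=; apply: le_lt_trans (xN _ _ (leqnn N) Nn) _.
by rewrite ltr_pdivrMr // mulr_natr mulr2n ltrDl.
Qed.

Let ReB (x y : C) : complex.Re (x - y) = complex.Re x - complex.Re y.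
Proof. by case: x; case: y. Qed.

Let ImB (x y : C) : complex.Im (x - y) = complex.Im x - complex.Im y.
Proof. by case: x; case: y. Qed.

(** The limit is taken coefficientwise. A bound on the partial sums for [u n - u m], uniform in
    their length, survives m -> oo and so bounds the whole norm of [u n - v]. *)
Lemma completeH u : cauchyH u -> exists f, cvgH u f.
Proof.
move=> uC.
have coefC a (e : R) : 0 < e -> exists N, forall m n, (N <= m)%N -> (N <=
  n)%N ->
    rprod (u m a - u n a) (u m a - u n a) <= e ^+ 2.
  move=> e0; have w0 := mweight_gt0 R a.
  have sw0 : 0 < Num.sqrt (mweight R a) by rewrite sqrtr_gt0.
  have [N uN] := uC _ (mulr_gt0 e0 sw0).
  exists N => m n Nm Nn.
  rewrite -(ler_pM2l w0); apply: le_trans (rnorm_coef (u m - u n) a) _.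
  rewrite -sqr_rnorm mulrC -[X in _ <= _ * X]sqr_sqrtr ?(ltW w0) // -exprMn.
  by rewrite ler_sqr ?nnegrE ?rnorm_ge0 ?uN // mulr_ge0 ?sqrtr_ge0 // ltW.
have cvgRe a : cvgn (fun n => complex.Re (u n a)).
  apply: real_cauchy_cvg => e e0; have [N uN] := coefC a e e0.
  exists N => m n Nm Nn;
    rewrite -ler_sqr ?nnegrE ?(ltW e0) // real_normK ?num_real //.
  apply: le_trans (uN m n Nm Nn).
  by case: (u m a) (u n a) => [? ?] [? ?];
    rewrite /rprod /= -!expr2 lerDl sqr_ge0.
have cvgIm a : cvgn (fun n => complex.Im (u n a)).
  apply: real_cauchy_cvg => e e0; have [N uN] := coefC a e e0.
  exists N => m n Nm Nn;
    rewrite -ler_sqr ?nnegrE ?(ltW e0) // real_normK ?num_real //.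
  apply: le_trans (uN m n Nm Nn).
  by case: (u m a) (u n a) => [? ?] [? ?];
    rewrite /rprod /= -!expr2 lerDr sqr_ge0.
pose v a := limn (fun n => complex.Re (u n a)) +i* limn (fun n => complex.Im (u
  n a)).
have vE n l : (fun m => hrdot l (u n - u m) (u n - u m)) x @[x --> \oo] -->
    hrdot l (fun a => u n a - v a) (fun a => u n a - v a).
  rewrite /hrdot; apply: cvg_big; first exact: add_continuous.
  move=> a _; apply: cvgM; first exact: cvg_cst.
  have cRe : complex.Re (u n a - u m a) @[m --> \oo] --> complex.Re (u n a - v
    a).
    rewrite ReB; under eq_fun do rewrite ReB.
    by apply: cvgB; [exact: cvg_cst|exact: cvgRe].
  have cIm : complex.Im (u n a - u m a) @[m --> \oo] --> complex.Im (u n a - v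
    a).
    rewrite ImB; under eq_fun do rewrite ImB.
    by apply: cvgB; [exact: cvg_cst|exact: cvgIm].
  by rewrite /rprod; apply: cvgD; apply: cvgM.
have vN (e : R) : 0 < e -> exists N, forall n L, (N <= n)%N ->
    series (fun l => complex.Re
      (hdot l (fun a => u n a - v a) (fun a => u n a - v a))) L <= e ^+ 2.
  move=> e0; have [N uN] := uC e e0; exists N => n L Nn.
  rewrite /series /=; under eq_bigr do rewrite Re_hdot.
  have cv : (\sum_(0 <= l < L) hrdot l (u n - u m) (u n - u m)) @[m --> \oo] -->
      \sum_(0 <= l < L) hrdot l (fun a => u n a - v a) (fun a => u n a - v a).
    by apply: cvg_big => [|l _]; [exact: add_continuous|exact: vE].
  apply: (cvgr_to_le cv); exists N => // m /= Nm.
  apply: le_trans (_ : rdot (u n - u m) (u n - u m) <= _); last first.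
    by rewrite -sqr_rnorm ler_sqr ?nnegrE ?rnorm_ge0 ?uN ?(ltW e0).
  rewrite rdotE; apply: le_trans (normsq_ub L (@H2_summable _ _ (u n - u m))).
  by rewrite /series /=; under [leRHS]eq_bigr do rewrite Re_hdot.
have [N0 vN0] := vN 1 ltr01.
have S0 : square_summable (fun a => u N0 a - v a).
  by apply: (@square_summableP _ _ _ (1 ^+ 2)) => L; exact: vN0.
(* Summability is first known for [u N0 - v]; subtracting this from [u N0] makes [v] an element of
   [H]. *)
pose f := u N0 - MkH2 (asboolT S0).
have fE a : f a = v a by rewrite /f -[LHS]/(u N0 a - (u N0 a - v a)) subKr.
exists f => e e0; have [N {}vN] := vN e e0; exists N => n Nn.
apply: rnorm_le; first exact: ltW.
rewrite rdotE; apply: normsq_le; first exact: H2_summable.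
move=> L; apply: le_trans (vN n L Nn).
rewrite (_ : (fun a => u n a - v a) = (u n - f : H)) //.
by apply/funext => a; rewrite -fE.
Qed.

Definition linsub K :=
  K 0 /\ forall (c : C) f g, K f -> K g -> K (c *: f + g).

Lemma linsubD K f g : linsub K -> K f -> K g -> K (f + g).
Proof. by move=> [_ Kl] Kf Kg; rewrite -[f]scale1r; exact: Kl. Qed.

Lemma linsubZ K c f : linsub K -> K f -> K (c *: f).
Proof. by move=> [K0 Kl] Kf; rewrite -[_ *: _]addr0; exact: Kl. Qed.

Lemma linsubB K f g : linsub K -> K f -> K g -> K (f - g).
Proof.
by move=> sK Kf Kg; rewrite -scaleN1r; apply: linsubD => //; exact: linsubZ.
Qed.

Lemma linsub_sum K (I : Type) (r : seq I) (P : pred I) (F : I -> H) :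
  linsub K -> (forall i, P i -> K (F i)) -> K (\sum_(i <- r | P i) F i).
Proof.
move=> sK KF; apply: big_ind => //; first by case: sK.
by move=> f g; exact: linsubD.
Qed.

Lemma cvgH_closed K u f : closed K -> (forall n, K (u n)) -> cvgH u f -> K f.
Proof.
move=> clK Ku uf; apply: closed_approx => // e e0; have [N uN] := uf e e0.
by exists (u N) => //; rewrite rnorm_distC uN.
Qed.

(** [a], [b], [q] stand for the squared distances from f to u_i, u_j and their midpoint, [m] for the
    distance to K. The constant comes from 4 (m + t)^2 - 4 m^2 = 8 m t + 4 t^2 <= (8 m + 4) t for t
    <= 1. *)
Let near_min (m t a b q e : R) : 0 <= t -> t <= 1 -> (8 * m + 4) * t <=
  e ^+ 2 ->
  a <= (m + t) ^+ 2 -> b <= (m + t) ^+ 2 -> m ^+ 2 <= q ->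
  2 * a + 2 * b - 4 * q <= e ^+ 2.
Proof.
move=> t0 t1; have : 0 <= t * (1 - t) by rewrite mulr_ge0 ?subr_ge0.
by lra.
Qed.

(** A minimising sequence is Cauchy by the parallelogram law, since midpoints of its terms stay in
    [K] and cannot be nearer than the infimum. *)
Lemma nearest_point K f : closed K -> linsub K ->
  exists2 p, K p & forall g, K g -> rnorm (f - p) <= rnorm (f - g).
Proof.
move=> clK sK; pose E := [set rnorm (f - g) | g in K]; pose m := inf E.
have E0 : lbound E 0 by move=> _ [g _ <-]; exact: rnorm_ge0.
have infE : has_inf E.
  by split; [exists (rnorm (f - 0)), 0 => //; case: sK|exists 0].
have m_le g : K g -> m <= rnorm (f - g).
  by move=> Kg; apply: ge_inf; [exists 0|exists g].
have m0 : 0 <= m by apply: lb_le_inf => //; case: infE.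
have /choice[u uP] n : exists g, K g /\ rnorm (f - g) <= m + n.+1%:R^-1.
  have n0 : 0 < n.+1%:R^-1 :> R by rewrite invr_gt0.
  by have [_ [g Kg <-] /ltW mg] := inf_adherent n0 infE; exists g.
have small (e : R) : 0 < e -> exists N, forall n, (N <= n)%N -> n.+1%:R^-1 <= e.
  move=> e0; exists (Num.trunc e^-1) => n Nn.
  rewrite -[leRHS]invrK lef_pV2 ?posrE ?invr_gt0 //; apply: ltW.
  apply: lt_le_trans (truncnS_gt _) _.
  by rewrite ler_nat ltnS.
have uC : cauchyH u.
  move=> e e0; pose c := 8 * m + 4; have c0 : 0 < c by rewrite /c; lra.
  pose t := Num.min 1 (e ^+ 2 / c).
  have t0 : 0 < t by rewrite lt_min ltr01 divr_gt0 ?exprn_gt0.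
  have [N Nt] := small t t0; exists N => i j Ni Nj.
  apply: rnorm_le; first exact: ltW.
  have K2 : K ((2^-1 : R)%:C *: (u i + u j)).
    by apply: linsubZ => //; apply: linsubD => //; [case: (uP i)|case: (uP j)].
  have ui n : (N <= n)%N -> rdot (f - u n) (f - u n) <= (m + t) ^+ 2.
    move=> Nn; rewrite -sqr_rnorm ler_sqr ?nnegrE ?rnorm_ge0 ?addr_ge0 ?(ltW
      t0) //.
    by apply: le_trans (uP n).2 _; rewrite lerD2l Nt.
  have mid : m ^+ 2 <= rdot (f - (2^-1 : R)%:C *: (u i + u j))
                            (f - (2^-1 : R)%:C *: (u i + u j)).
    by rewrite -sqr_rnorm ler_sqr ?nnegrE ?rnorm_ge0 ?m_le.
  have par : rdot (u i - u j) (u i - u j) =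
      2 * rdot (f - u i) (f - u i) + 2 * rdot (f - u j) (f - u j) -
      4 * rdot (f - (2^-1 : R)%:C *: (u i + u j))
               (f - (2^-1 : R)%:C *: (u i + u j)).
    rewrite !rdotBl !rdotBr !rdotZl !rdotZr !rdotDl !rdotDr.
    rewrite (rdotC (u j) (u i)) (rdotC (u i) f) (rdotC (u j) f).
    by field.
  have t1 : t <= 1 by rewrite ge_min lexx.
  have tc : c * t <= e ^+ 2.
    by rewrite mulrC -ler_pdivlMr // ge_min lexx orbT.
  by rewrite par; apply: (@near_min m t) => //;
    [exact: ltW|exact: ui|exact: ui].
have [p up] := completeH uC; exists p.
  by apply: (cvgH_closed clK _ up) => n; case: (uP n).
move=> g Kg; apply: le_trans (m_le g Kg); apply/ler_addgt0Pr => e e0.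
have e2 : 0 < e / 2 by rewrite divr_gt0.
have [N1 H1] := small _ e2; have [N2 H2] := up _ e2.
apply: le_trans (rnorm_triangle (u (maxn N1 N2)) _ _) _.
rewrite [leRHS](_ : _ = m + e / 2 + e / 2); last by field.
apply: lerD; last by apply: H2; exact: leq_maxr.
apply: le_trans (uP (maxn N1 N2)).2 _.
by rewrite lerD2l; apply: H1; exact: leq_maxl.
Qed.

Lemma orthogonal_projection K f : closed K -> linsub K ->
  exists p, K p /\ forall g, K g -> rdot (f - p) g = 0.
Proof.
move=> clK sK; have [p Kp pP] := nearest_point f clK sK.
exists p; split=> // g Kg; have [->|g0] := eqVneq g 0; first exact: rdot0r.
have q0 : 0 < rdot g g.
  rewrite lt_neqAle rdot_ge0 andbT; apply: contra g0 => /eqP g0.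
  by apply/eqP/rdot_eq0.
(* The minimiser of |f - p - t g| over real t. There the squared norm drops by <f - p, g>^2 / <g,
   g>, which the minimality of p forces to be zero. *)
pose t := rdot (f - p) g / rdot g g.
have : rdot (f - p) (f - p) <= rdot (f - p - t%:C *: g) (f - p - t%:C *: g).
  rewrite -!sqr_rnorm ler_sqr ?nnegrE ?rnorm_ge0 //.
  rewrite -addrA -opprD; apply: pP.
  by apply: linsubD => //; apply: linsubZ.
rewrite [leRHS]rdotBl !(rdotBr (f - p)) rdotBr !rdotZl !rdotZr (rdotC g).
rewrite -subr_ge0 (_ : _ - _ = - (rdot (f - p) g ^+ 2 / rdot g g)).
  rewrite oppr_ge0 pmulr_lle0 ?invr_gt0 // => c0.
  by apply/eqP; rewrite -sqrf_eq0 eq_le c0 sqr_ge0.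
by rewrite /t; field; rewrite gt_eqF.
Qed.

Definition oproj K f : H :=
  xget 0 [set p | K p /\ forall g, K g -> rdot (f - p) g = 0].

Section Projection.
Variable K : set H.
Hypotheses (clK : closed K) (sK : linsub K).

Lemma oproj_in f : K (oproj K f).
Proof.
have [p pP] := orthogonal_projection f clK sK.
by have [] : [set p | K p /\ forall g, K g -> rdot (f - p) g = 0] (oproj K f)
  := xgetPex 0 (ex_intro _ p pP).
Qed.

Lemma oproj_orth f g : K g -> rdot (f - oproj K f) g = 0.
Proof.
have [p pP] := orthogonal_projection f clK sK.
have [_ H0] : [set p | K p /\ forall g, K g -> rdot (f - p) g = 0] (oproj K f)
  := xgetPex 0 (ex_intro _ p pP).
exact: H0.
Qed.

Lemma oproj_unique f p :
  K p -> (forall g, K g -> rdot (f - p) g = 0) -> oproj K f = p.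
Proof.
move=> Kp pP; apply/eqP; rewrite -subr_eq0; apply/eqP/rdot_eq0.
have Kd : K (oproj K f - p) by apply: linsubB => //; exact: oproj_in.
rewrite -[X in rdot X _](_ : (f - p) - (f - oproj K f) = _).
  by rewrite rdotBl pP // oproj_orth // subrr.
by rewrite opprB addrC addrA subrK.
Qed.

Lemma oproj_id f : K f -> oproj K f = f.
Proof. by move=> Kf; apply: oproj_unique => // g _; rewrite subrr rdot0l. Qed.

(** Complex linearity holds although orthogonality is real: [c] is moved onto the test vector, and
    [c^* *: h] is still in [K]. *)
Lemma oproj_linear (c : C) f g : oproj K (c *: f + g) = c *:
  oproj K f + oproj K g.
Proof.
apply: oproj_unique; first by case: sK => _; apply; exact: oproj_in.
move=> h Kh; rewrite opprD addrACA -scalerBr rdotDl rdotZJ.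
rewrite -[RHS]addr0; congr (_ + _); last exact: oproj_orth.
exact: (oproj_orth f (linsubZ _ sK Kh)).
Qed.

Lemma rdot_oproj f g : K g -> rdot (oproj K f) g = rdot f g.
Proof.
by move=> Kg; apply/esym/eqP; rewrite -subr_eq0 -rdotBl (oproj_orth f Kg).
Qed.

Lemma oproj_pythagoras f :
  rdot f f = rdot (oproj K f) (oproj K f) + rdot (f - oproj K f) (f - oproj K
    f).
Proof.
have := rdot_oproj f (oproj_in f).
by rewrite !rdotBl !rdotBr (rdotC (oproj K f) f) => ->; ring.
Qed.

Lemma oproj_contraction f : rdot (oproj K f) (oproj K f) <= rdot f f.
Proof. by rewrite (oproj_pythagoras f) lerDl rdot_ge0. Qed.

End Projection.

(** * Square roots of 1 - A for a self-adjoint contraction A *)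

Definition linear_op A := forall (c : C) f g, A (c *: f + g) = c *: A f + A g.

Section LinearOp.
Variable A : H -> H.
Hypothesis linA : linear_op A.

Lemma linear_op0 : A 0 = 0.
Proof.
have := linA 1 0 0; rewrite !scale1r addr0 => /eqP.
by rewrite -[X in X == _]addr0 (inj_eq (addrI _)) eq_sym => /eqP.
Qed.

Lemma linear_opZ c f : A (c *: f) = c *: A f.
Proof. by rewrite -[c *: f]addr0 linA linear_op0 addr0. Qed.

Lemma linear_opB f g : A (f - g) = A f - A g.
Proof. by rewrite -scaleN1r addrC linA scaleN1r addrC. Qed.

End LinearOp.

(* Visser's iteration for Y = 1 - (1 - A)^(1/2), that is for Y = (A + Y^2) / 2;
   [sqrt_iter_bd] is the same iteration for A = 1. *)
Fixpoint sqrt_iter A n f : H :=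
  if n is m.+1 then (2^-1 : R)%:C *: (A f + sqrt_iter A m (sqrt_iter A m f))
  else 0.

Fixpoint sqrt_iter_bd n : R :=
  if n is m.+1 then 2^-1 * (1 + sqrt_iter_bd m ^+ 2) else 0.

Lemma sqrt_iter_bd_ge0 n : 0 <= sqrt_iter_bd n.
Proof.
by case: n => //= n; rewrite mulr_ge0 ?addr_ge0 ?sqr_ge0 // invr_ge0.
Qed.

Lemma sqrt_iter_bd_le1 n : sqrt_iter_bd n <= 1.
Proof.
elim: n => //= n IH; have := sqrt_iter_bd_ge0 n.
have : sqrt_iter_bd n ^+ 2 <= 1 by rewrite expr_le1 ?sqrt_iter_bd_ge0.
lra.
Qed.

Lemma sqrt_iter_bd_nd n : sqrt_iter_bd n <= sqrt_iter_bd n.+1.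
Proof.
elim: n => [|n IH]; first by rewrite sqrt_iter_bd_ge0.
change (2^-1 * (1 + sqrt_iter_bd n ^+ 2) <=
  2^-1 * (1 + sqrt_iter_bd n.+1 ^+ 2)).
rewrite ler_wpM2l ?invr_ge0 // lerD2l.
by rewrite lerXn2r ?nnegrE ?sqrt_iter_bd_ge0.
Qed.

Section SquareRoot.
Variable A : H -> H.
Hypotheses (linA : linear_op A)
  (selfA : forall f g, rdot (A f) g = rdot f (A g))
  (contrA : forall f, rnorm (A f) <= rnorm f).
Local Notation Y := (sqrt_iter A).
Local Notation s := sqrt_iter_bd.

Lemma sqrt_iter_linear n : linear_op (Y n).
Proof.
elim: n => [|n IH] c f g /=; first by rewrite scaler0 addr0.
rewrite linA !IH [c *: (_ *: _)]scalerA mulrC -scalerA -scalerDr;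
  congr (_ *: _).
by rewrite scalerDr addrACA.
Qed.

Lemma sqrt_iter_selfadj n f g : rdot (Y n f) g = rdot f (Y n g).
Proof.
elim: n f g => [|n IH] f g /=; first by rewrite rdot0l rdot0r.
by rewrite rdotZl rdotZr rdotDl rdotDr selfA !IH.
Qed.

Lemma rnorm_sqrt_iter n f : rnorm (Y n f) <= s n * rnorm f.
Proof.
elim: n f => [|n IH] f /=; first by rewrite rnorm0 mul0r.
rewrite rnormZ ?invr_ge0 // -mulrA ler_wpM2l ?invr_ge0 //.
apply: le_trans (rnormD _ _) _; rewrite mulrDl mul1r lerD //.
apply: le_trans (IH _) _.
by rewrite expr2 -mulrA ler_wpM2l ?sqrt_iter_bd_ge0.
Qed.

(* Y_(n+1)^2 - Y_n^2 = Y_(n+1) (Y_(n+1) - Y_n) + (Y_(n+1) - Y_n) Y_n: no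
   commutation is needed to compare with the scalar iteration. *)
Lemma rnorm_sqrt_iterB n f :
  rnorm (Y n.+1 f - Y n f) <= (s n.+1 - s n) * rnorm f.
Proof.
elim: n f => [|n IH] f.
  rewrite subr0 /= addr0 rnormZ ?invr_ge0 // expr0n addr0 mulr1 subr0.
  by rewrite ler_wpM2l ?invr_ge0.
have -> : Y n.+2 f - Y n.+1 f = (2^-1 : R)%:C *:
    (Y n.+1 (Y n.+1 f - Y n f) + (Y n.+1 (Y n f) - Y n (Y n f))).
  rewrite (linear_opB (@sqrt_iter_linear n.+1)) addrA subrK.
  by rewrite [Y n.+2 f]/= [X in _ - X]/= -scalerBr opprD addrACA subrr add0r.
have -> : s n.+2 - s n.+1 =
    2^-1 * (s n.+1 * (s n.+1 - s n) + (s n.+1 - s n) * s n).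
  have sS k : s k.+1 = 2^-1 * (1 + s k ^+ 2) by [].
  by rewrite (sS n.+1); move: (s n.+1) (s n) (sS n) => x y; lra.
rewrite rnormZ ?invr_ge0 // -mulrA ler_wpM2l ?invr_ge0 //.
have sB : 0 <= s n.+1 - s n by rewrite subr_ge0 sqrt_iter_bd_nd.
apply: le_trans (rnormD _ _) _; rewrite mulrDl lerD //.
  apply: le_trans (rnorm_sqrt_iter _ _) _.
  by rewrite -mulrA ler_wpM2l ?sqrt_iter_bd_ge0 ?IH.
apply: le_trans (IH _) _.
by rewrite -mulrA ler_wpM2l // rnorm_sqrt_iter.
Qed.

Lemma rnorm_sqrt_iterBle m n f : (m <= n)%N ->
  rnorm (Y n f - Y m f) <= (s n - s m) * rnorm f.
Proof.
move=> /subnK <-; elim: (n - m)%N => [|k IH].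
  by rewrite !subrr rnorm0 mul0r.
rewrite addSn; apply: le_trans (rnorm_triangle (Y (k + m) f) _ _) _.
apply: le_trans (lerD (rnorm_sqrt_iterB _ _) IH) _.
by rewrite -mulrDl addrA subrK.
Qed.

(** The telescoped increments are dominated by those of the scalar iteration, which is nondecreasing
    and bounded by 1, hence convergent. *)
Lemma sqrt_iter_cauchy f : cauchyH (fun n => Y n f).
Proof.
have s_cvg : cvgn s.
  apply: nondecreasing_is_cvgn.
    by apply/nondecreasing_seqP; exact: sqrt_iter_bd_nd.
  by exists 1 => _ [n _ <-]; exact: sqrt_iter_bd_le1.
have s_le n : s n <= limn s.
  by apply: nondecreasing_cvgn_le => //; apply/nondecreasing_seqP;
    exact: sqrt_iter_bd_nd.
move=> e e0; pose r := rnorm f + 1.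
have r0 : 0 < r by rewrite ltr_wpDl ?rnorm_ge0.
have /cvgrPdist_le/(_ _ (divr_gt0 e0 r0))[N _ sN] := s_cvg.
have key m n : (N <= m)%N -> (m <= n)%N -> rnorm (Y n f - Y m f) <= e.
  move=> Nm mn; apply: le_trans (rnorm_sqrt_iterBle _ mn) _.
  have : s n - s m <= e / r.
    apply: le_trans (sN m Nm); rewrite ger0_norm ?subr_ge0 //.
    by rewrite lerD2r.
  rewrite ler_pdivlMr // => /(le_trans _); apply.
  rewrite ler_wpM2l ?lerDl // subr_ge0.
  move: mn => /subnK <-; elim: (n - m)%N => [|k /le_trans]; first by [].
  by apply; exact: sqrt_iter_bd_nd.
exists N => m n Nm Nn; have [mn|/ltnW nm] := leqP m n; last exact: key.
by rewrite rnorm_distC key.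
Qed.

Definition sqrt_lim f : H := xget 0 [set g | cvgH (fun n => Y n f) g].

Lemma sqrt_limP f : cvgH (fun n => Y n f) (sqrt_lim f).
Proof. exact: (xgetPex 0 (completeH (sqrt_iter_cauchy f))). Qed.

End SquareRoot.

Lemma cvgH_unique u f g : cvgH u f -> cvgH u g -> f = g.
Proof.
move=> uf ug; apply/eqP; rewrite -subr_eq0; apply/eqP/rnorm_eq0.
apply: le0_small => [|e e0]; first exact: rnorm_ge0.
have e2 : 0 < e / 2 by rewrite divr_gt0.
have [N1 H1] := uf _ e2; have [N2 H2] := ug _ e2.
apply: le_trans (rnorm_triangle (u (maxn N1 N2)) _ _) _.
rewrite [leRHS](splitr e); apply: lerD.
  by rewrite rnorm_distC; apply: H1; exact: leq_maxl.
by apply: H2; exact: leq_maxr.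
Qed.

Lemma cvgHD u (v : nat -> H) f g :
  cvgH u f -> cvgH v g -> cvgH (fun n => u n + v n) (f + g).
Proof.
move=> uf vg e e0; have e2 : 0 < e / 2 by rewrite divr_gt0.
have [N1 H1] := uf _ e2; have [N2 H2] := vg _ e2; exists (maxn N1 N2) => n.
rewrite geq_max => /andP[N1n N2n]; rewrite opprD addrACA [leRHS](splitr e).
by apply: le_trans (rnormD _ _) _; apply: lerD; [exact: H1|exact: H2].
Qed.

Lemma rnormZC (c : C) f : rnorm (c *: f) = complex.Re `|c| * rnorm f.
Proof.
by apply: (@complexI R); rewrite -normE normrZ normE rmorphM normc_def.
Qed.

Lemma cvgHZ (c : C) u f : cvgH u f -> cvgH (fun n => c *: u n) (c *: f).
Proof.
move=> uf e e0; pose r := complex.Re `|c|.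
have r0 : 0 <= r by rewrite /r normc_def /= sqrtr_ge0.
have r1 : 0 < r + 1 by rewrite ltr_wpDl.
have [N uN] := uf _ (divr_gt0 e0 r1); exists N => n /uN.
rewrite ler_pdivlMr // -scalerBr rnormZC -/r => /(le_trans _); apply.
by rewrite mulrC ler_wpM2l ?rnorm_ge0 // lerDl.
Qed.

Lemma cvgH_shift u f : cvgH u f -> cvgH (fun n => u n.+1) f.
Proof.
by move=> uf e /uf[N uN]; exists N => n Nn; apply: uN; exact: leqW.
Qed.

Lemma cvgH_rdot u f g : cvgH u f -> forall e : R, 0 < e ->
  exists N, forall n, (N <= n)%N -> `|rdot (u n) g - rdot f g| <= e.
Proof.
move=> uf e e0.
have r1 : 0 < rnorm g + 1 by rewrite ltr_wpDl ?rnorm_ge0.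
have [N uN] := uf _ (divr_gt0 e0 r1); exists N => n /uN.
rewrite -rdotBl ler_pdivlMr // => ?; apply: le_trans (cauchy_schwarz _ _) _.
apply: le_trans (_ : rnorm (u n - f) * (rnorm g + 1) <= _) => //.
by rewrite ler_wpM2l ?rnorm_ge0 // lerDl.
Qed.

Lemma cvgH_rdot_eq u (v : nat -> H) f g h k : cvgH u f -> cvgH v g ->
  (forall n, rdot (u n) h = rdot (v n) k) -> rdot f h = rdot g k.
Proof.
move=> uf vg uv; apply/eqP; rewrite -subr_eq0 -normr_eq0;
  apply/eqP/le0_small => // e e0.
have e2 : 0 < e / 2 by rewrite divr_gt0.
have [N1 H1] := cvgH_rdot h uf e2; have [N2 H2] := cvgH_rdot k vg e2.
have {}H1 := H1 _ (leq_maxl N1 N2); have {}H2 := H2 _ (leq_maxr N1 N2).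
rewrite -(subrKA (rdot (u (maxn N1 N2)) h)) [leRHS](splitr e).
apply: le_trans (ler_normD _ _) _; rewrite distrC; apply: lerD => //.
by rewrite uv.
Qed.

(** With Y the limit of the iteration, D = 1 - Y has square 1 - 2 Y + Y^2 = 1 - A, and it is
    positive because Y is a contraction. The clause on subspaces brings the root, built on all of
    [H], back to a given K. *)
Lemma exists_sqrt A : linear_op A ->
  (forall f g, rdot (A f) g = rdot f (A g)) ->
  (forall f, rnorm (A f) <= rnorm f) ->
  exists D, [/\ linear_op D,
    forall f g, rdot (D f) g = rdot f (D g),
    forall f, rnorm (D f) <= 2 * rnorm f,
    forall f, 0 <= rdot (D f) f &
    (forall f, D (D f) = f - A f) /\
    (forall K, closed K -> linsub K -> (forall f, K f -> K (A f)) ->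
      forall f, K f -> K (D f))].
Proof.
move=> linA selfA contrA; pose Y := sqrt_lim A.
have YP f : cvgH (fun n => sqrt_iter A n f) (Y f) by exact: sqrt_limP.
have linY : linear_op Y.
  move=> c f g; apply: cvgH_unique (YP _) _.
  rewrite (_ : (fun n => _) =
      fun n => c *: sqrt_iter A n f + sqrt_iter A n g); last first.
    by apply/funext => n; exact: sqrt_iter_linear.
  by apply: cvgHD; [exact: cvgHZ|exact: YP].
have normY f : rnorm (Y f) <= rnorm f.
  apply/ler_addgt0Pr => e e0; have [N /(_ N (leqnn N)) uN] := YP f e e0.
  have := rnorm_triangle (sqrt_iter A N f) (Y f) 0; rewrite !subr0.
  move=> /le_trans; apply; rewrite rnorm_distC addrC; apply: lerD => //.
  apply: le_trans (rnorm_sqrt_iter contrA _ _) _.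
  by rewrite ler_piMl ?rnorm_ge0 ?sqrt_iter_bd_le1.
have selfY f g : rdot (Y f) g = rdot f (Y g).
  rewrite [RHS]rdotC; apply: cvgH_rdot_eq (YP f) (YP g) _ => n.
  by rewrite sqrt_iter_selfadj // rdotC.
have YE f : Y f = (2^-1 : R)%:C *: (A f + Y (Y f)).
  apply: cvgH_unique (cvgH_shift (YP f)) _.
  apply: cvgHZ; apply: cvgHD.
    by move=> e e0; exists 0%N => n _; rewrite subrr rnorm0 ltW.
  move=> e e0; have e2 : 0 < e / 2 by rewrite divr_gt0.
  have [N1 H1] := YP f _ e2; have [N2 H2] := YP (Y f) _ e2.
  exists (maxn N1 N2) => n; rewrite geq_max => /andP[N1n N2n].
  (* Y_n Y_n f - Y Y f = Y_n (Y_n f - Y f) + (Y_n - Y) Y f, where each Y_n is a contraction. *)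
  apply: le_trans (rnorm_triangle (sqrt_iter A n (Y f)) _ _) _.
  rewrite [leRHS](splitr e); apply: lerD; last exact: H2.
  rewrite -(linear_opB (sqrt_iter_linear linA n)).
  apply: le_trans (rnorm_sqrt_iter contrA _ _) _; apply: le_trans (H1 n N1n).
  by rewrite ler_piMl ?rnorm_ge0 ?sqrt_iter_bd_le1.
have two : (2^-1 : R)%:C + (2^-1 : R)%:C = 1 :> C.
  by rewrite -rmorphD (_ : 2^-1 + 2^-1 = 1 :> R) ?rmorph1 //; field.
have YYE f : Y f + Y f - A f = Y (Y f).
  rewrite {1 2}(YE f) -scalerDl two scale1r.
  by rewrite addrAC subrr add0r.
exists (fun f => f - Y f); split.
- by move=> c f g; rewrite linY opprD addrACA -scalerBr.
- by move=> f g; rewrite rdotBl rdotBr selfY.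
- move=> f; apply: le_trans (rnormD _ _) _.
  by rewrite rnormN mulrDl mul1r lerD.
- move=> f; rewrite rdotBl subr_ge0 -sqr_rnorm expr2.
  apply: le_trans (ler_norm _) _; apply: le_trans (cauchy_schwarz _ _) _.
  by rewrite ler_wpM2r ?rnorm_ge0.
split.
  move=> f; rewrite (linear_opB linY) -YYE.
  move: (Y f) (A f) => y z.
  have -> : y - (y + y - z) = z - y by rewrite opprB addrC opprD addrA subrK.
  by rewrite opprB addrA subrK.
move=> K clK sK KA; have KY n f : K f -> K (sqrt_iter A n f).
  elim: n f => [|n IH] f Kf /=; first by case: sK.
  by apply: linsubZ => //; apply: linsubD => //; [exact: KA|apply/IH/IH].
move=> f Kf; apply: linsubB => //; apply: (cvgH_closed clK _ (YP f)) => n.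
exact: KY.
Qed.

End HilbertSpace.

(** * Adjoints of the coordinate multiplications, and homogeneous components *)

Section Grading.
Local Open Scope complex_scope.
Variables (R : realType) (d : nat).
Local Notation C := R[i].
Local Notation M := (midx d).
Local Notation H := (H2 R d).
Implicit Types (f g h : H) (u v : M -> C) (K : set H) (a b : M) (P : pred M).

Lemma H2P f g : (forall a, f a = g a) -> f = g.
Proof. by move=> fg; apply: val_inj; apply/funext. Qed.

Lemma H2DE f g a : (f + g) a = f a + g a. Proof. by []. Qed.
Lemma H2BE f g a : (f - g) a = f a - g a. Proof. by []. Qed.
Lemma H2ZE (c : C) f a : (c *: f) a = c * f a. Proof. by []. Qed.

Lemma H2sumE (I : Type) (r : seq I) (Q : pred I) (F : I -> H) a :
  (\sum_(i <- r | Q i) F i) a = \sum_(i <- r | Q i) F i a.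
Proof. exact: (big_morph (fun f : H => f a)). Qed.

Lemma zmulE k f a :
  zmul k f a = if a k == 0%N then 0 else f (mdec k a).
Proof. by []. Qed.

Lemma zmul_linear k : linear_op (@zmul R d k).
Proof.
move=> c f g; apply: H2P => a; rewrite H2DE H2ZE !zmulE H2DE H2ZE.
by case: ifP => _; rewrite ?mulr0 ?addr0.
Qed.

Lemma mseqS_perm k n :
  perm_eq [seq a : M <- mseq d n.+1 | a k != 0%N] (map (minc k) (mseq d n)).
Proof.
apply: uniq_perm; rewrite ?filter_uniq ?map_inj_uniq ?mseq_uniq //.
  exact: can_inj (mincK k).
move=> a; rewrite mem_filter mem_mseq; apply/andP/mapP => [[ak /eqP an]|[b]].
  rewrite -lt0n in ak; exists (mdec k a); rewrite ?mdecK //.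
  by rewrite mem_mseq -eqSS -(mdeg_minc k) mdecK // an.
by rewrite mem_mseq => /eqP <- ->; rewrite mdeg_minc !ffunE eqxx addn1.
Qed.

(** The quotient of the squared norms of z^(a + e_k) and z^a. *)
Definition zratio k a : R := (a k).+1%:R / (mdeg a).+1%:R.

Lemma mweight_mincE k a : mweight R (minc k a) = mweight R a * zratio k a.
Proof.
rewrite /mweight mfact_minc mdeg_minc factS !natrM invfM /zratio.
by rewrite [LHS]mulrACA mulrC.
Qed.

Lemma zratio_ge0 k a : 0 <= zratio k a.
Proof. by rewrite divr_ge0. Qed.

Lemma zratio_le1 k a : zratio k a <= 1.
Proof.
rewrite ler_pdivrMr ?ltr0n // mul1r ler_nat ltnS /mdeg.
by rewrite (bigD1 k) //= leq_addr.
Qed.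

(** The adjoint of multiplication by z_k on H^2: the index is shifted, and the change of weight
    appears as a factor. *)
Definition zadj_coef k u : M -> C := fun a => (zratio k a)%:C * u (minc k a).

Lemma hrdot_shift0 k u v : hrdot 0 (shift_coef k u) v = 0.
Proof.
rewrite /hrdot big1_seq // => a /andP[_]; rewrite mem_mseq => /eqP a0.
have ak : a k = 0%N.
  by apply/eqP; move/eqP: a0; rewrite /mdeg sum_nat_eq0 => /forallP/(_ k).
by rewrite /shift_coef ak /rprod /= !mul0r addr0 mulr0.
Qed.

Lemma hrdot_shiftS k n u v :
  hrdot n.+1 (shift_coef k u) v = hrdot n u (zadj_coef k v).
Proof.
rewrite /hrdot (bigID (fun a : M => a k != 0%N)) /= [X in _ + X]big1 ?addr0.
  rewrite -big_filter (perm_big _ (mseqS_perm k n)) big_map.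
  apply: eq_bigr => a _; rewrite /shift_coef mincK ffunE eqxx addn1 /=.
  rewrite mweight_mincE /zadj_coef /rprod.
  by case: (u a) (v _) => [? ?] [? ?] /=; ring.
move=> a; rewrite negbK /shift_coef => ->.
by rewrite /rprod /= !mul0r addr0 mulr0.
Qed.

Lemma hrdot_zadj_le k n u :
  hrdot n (zadj_coef k u) (zadj_coef k u) <= hrdot n.+1 u u.
Proof.
rewrite [leRHS]/hrdot (bigID (fun a : M => a k != 0%N)) /=.
apply: ler_wpDr.
  by apply: sumr_ge0 => a _; rewrite mulr_ge0 ?rprod_ge0 // ltW // mweight_gt0.
rewrite -big_filter (perm_big _ (mseqS_perm k n)) big_map.
apply: ler_sum => a _;
  rewrite mweight_mincE -mulrA ler_wpM2l ?(ltW (mweight_gt0 _ _)) //.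
rewrite (_ : rprod _ _ =
  zratio k a * (zratio k a * rprod (u (minc k a)) (u (minc k a)))).
  by rewrite ler_wpM2l ?zratio_ge0 // ler_piMl ?rprod_ge0 // zratio_le1.
by rewrite /zadj_coef /rprod; case: (u (minc k a)) => x y /=; ring.
Qed.

Lemma square_summable_zadj k f : square_summable (zadj_coef k f).
Proof.
apply: (@square_summableP _ _ _ (normsq f)) => N.
apply: le_trans (normsq_ub N.+1 (@H2_summable _ _ f)).
rewrite /series /= big_nat_recl //= !Re_hdot.
apply: ler_wpDl; first exact: hrdot_ge0.
by apply: ler_sum => n _; rewrite !Re_hdot; exact: hrdot_zadj_le.
Qed.

Definition zadj k f : H := MkH2 (asboolT (@square_summable_zadj k f)).

Lemma zadjE k f a : zadj k f a = (zratio k a)%:C * f (minc k a).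
Proof. by []. Qed.

Lemma zadj_linear k : linear_op (@zadj k).
Proof.
move=> c f g; apply: H2P => a; rewrite H2DE H2ZE !zadjE H2DE H2ZE.
by rewrite mulrDr mulrCA.
Qed.

Lemma zmul_adj k f g : rdot (zmul k f) g = rdot f (zadj k g).
Proof.
(* Multiplication raises the degree, so the left series vanishes in degree 0 and is the right one
   shifted by one. *)
apply/cvg_lim => //; rewrite -cvg_shiftS.
rewrite (_ : (fun n => _) = series (fun n => hrdot n f (zadj k g))).
  exact: is_cvg_hrdot.
apply/funext => n; rewrite /series /= big_nat_recl //= hrdot_shift0 add0r.
by apply: eq_bigr => i _; rewrite hrdot_shiftS.
Qed.

(** The factors met at [a] are a_k / |a|, which sum to 1 in positive degree. *)
Lemma sum_zmul_zadj f a :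
  (\sum_k zmul k (zadj k f)) a = if mdeg a == 0%N then 0 else f a.
Proof.
rewrite H2sumE; transitivity (\sum_k ((a k)%:R / (mdeg a)%:R)%:C * f a).
  apply: eq_bigr => k _; rewrite zmulE; case: eqP => [->|/eqP].
    by rewrite mul0r mul0r.
  rewrite -lt0n => ak; rewrite zadjE mdecK //; congr (_%:C * _).
  rewrite /zratio -(mdeg_minc k) mdecK //; congr (_%:R / _).
  by rewrite ffunE eqxx subn1 prednK.
rewrite -mulr_suml -(rmorph_sum (real_complex R)) -mulr_suml -natr_sum.
rewrite -/(mdeg a); case: eqP => [->|/eqP a0]; first by rewrite !mul0r.
by rewrite divff ?pnatr_eq0 // rmorph1 mul1r.
Qed.

Fact square_summable_mask P f :
  square_summable (fun a => if P a then f a else 0).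
Proof.
have [] // := @square_summable_le _ _ (fun a => if P a then f a else 0) f.
- by move=> a; case: ifP => // _; rewrite normr0.
- exact: H2_summable.
Qed.

Definition hmask P f : H := MkH2 (asboolT (@square_summable_mask P f)).

Lemma hmaskE P f a : hmask P f a = if P a then f a else 0.
Proof. by []. Qed.

Lemma hmask_linear P : linear_op (hmask P).
Proof.
move=> c f g; apply: H2P => a; rewrite H2DE H2ZE !hmaskE H2DE H2ZE.
by case: (P a); rewrite // mulr0 addr0.
Qed.

Lemma rdot_hmask P f g : rdot (hmask P f) g = rdot f (hmask P g).
Proof.
congr (limn (series _)); apply/funext => n; apply: eq_bigr => a _.
by rewrite !hmaskE; case: (P a); rewrite // /rprod /= !mul0r !mulr0.
Qed.

Lemma hmask_id P f : hmask P (hmask P f) = hmask P f.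
Proof. by apply: H2P => a; rewrite !hmaskE; case: (P a). Qed.

Definition hcomp n : H -> H := hmask (fun a => mdeg a == n).

Lemma hcompE n f a : hcomp n f a = if mdeg a == n then f a else 0.
Proof. by []. Qed.

Lemma hcomp_linear n : linear_op (hcomp n).
Proof. exact: hmask_linear. Qed.

Lemma rdot_hcomp n f : rdot (hcomp n f) (hcomp n f) = rdot f (hcomp n f).
Proof. by rewrite /hcomp rdot_hmask hmask_id. Qed.

Definition homog n f := forall a, mdeg a != n -> f a = 0.

Lemma homog_hcomp n f : homog n (hcomp n f).
Proof. by move=> a /negPf an; rewrite hmaskE an. Qed.

Lemma hcomp_id n f : homog n f -> hcomp n f = f.
Proof. by move=> hf; apply: H2P => a; rewrite hmaskE;
  case: eqP => // /eqP/hf. Qed.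

Lemma hcomp_neq m n f : homog n f -> m != n -> hcomp m f = 0.
Proof.
move=> hf mn; apply: H2P => a; rewrite hmaskE; case: eqP => // am.
by rewrite hf // am.
Qed.

Lemma homog_zmul k n f : homog n f -> homog n.+1 (zmul k f).
Proof.
move=> hf a an; rewrite zmulE; case: ifP => // /negbT; rewrite -lt0n => ak.
by apply: hf; rewrite -eqSS -(mdeg_minc k) mdecK.
Qed.

Lemma homog_zadj k n f : homog n.+1 f -> homog n (zadj k f).
Proof. by move=> hf a an; rewrite zadjE hf ?mulr0 // mdeg_minc eqSS. Qed.

Lemma rdot_homog n f g : homog n f -> rdot f g = rdot f (hcomp n g).
Proof. by move=> hf; rewrite -rdot_hmask -/(hcomp n f) hcomp_id. Qed.

Lemma sum_zmul_zadj_homog n f : homog n.+1 f -> \sum_k zmul k (zadj k f) = f.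
Proof.
move=> hf; apply: H2P => a; rewrite sum_zmul_zadj; case: eqP => // a0.
by rewrite hf // a0.
Qed.

Lemma sum_rdot_zadj f g :
  \sum_k rdot (zadj k f) (zadj k g) = rdot (\sum_k zmul k (zadj k f)) g.
Proof. by rewrite rdot_suml; apply: eq_bigr => k _; rewrite zmul_adj. Qed.

Lemma sum_zadj_le f : \sum_k rdot (zadj k f) (zadj k f) <= rdot f f.
Proof.
rewrite sum_rdot_zadj.
have -> : \sum_k zmul k (zadj k f) = f - hcomp 0 f.
  apply: H2P => a; rewrite sum_zmul_zadj H2BE hmaskE.
  by case: ifP => _; rewrite ?subrr ?subr0.
by rewrite rdotBl gerBl /hcomp -hmask_id rdot_hmask rdot_ge0.
Qed.

(** The row of multiplications is a contraction: with w the sum, <w, w> = sum_k <F_k, z_k^* w>, and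
    it remains to expand sum_k |F_k - z_k^* w|^2 >= 0 and use [sum_zadj_le]. *)
Lemma rdot_sum_zmul_le (F : 'I_d -> H) :
  rdot (\sum_k zmul k (F k)) (\sum_k zmul k (F k)) <= \sum_k rdot (F k) (F k).
Proof.
set w := \sum_k zmul k (F k).
have wE : rdot w w = \sum_k rdot (F k) (zadj k w).
  by rewrite {1}/w rdot_suml; apply: eq_bigr => k _; rewrite zmul_adj.
have : 0 <= \sum_k rdot (F k - zadj k w) (F k - zadj k w).
  by apply: sumr_ge0 => k _; exact: rdot_ge0.
have -> : \sum_k rdot (F k - zadj k w) (F k - zadj k w) =
    \sum_k rdot (F k) (F k) - 2 * \sum_k rdot (F k) (zadj k w) +
    \sum_k rdot (zadj k w) (zadj k w).
  rewrite mulr_sumr -sumrB -big_split; apply: eq_bigr => k _.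
  by move: (F k) (zadj k w) => x y; rewrite rdotBl !rdotBr (rdotC y x) /=; ring.
rewrite -wE; have := sum_zadj_le w; lra.
Qed.

Lemma tail_small f (e : R) : 0 < e -> exists N, forall g,
  (forall a, (mdeg a < N)%N -> g a = 0) -> (forall a, `|g a| <= `|f a|) ->
  rnorm g <= e.
Proof.
move=> e0; have e20 : 0 < e ^+ 2 by rewrite exprn_gt0.
have cf := @is_cvg_hrdot _ _ f f.
have /cvgrPdist_le/(_ _ e20)[N _ /(_ N (leqnn N)) fN] := cf.
exists N => g gN gf; apply: rnorm_le; first exact: ltW.
rewrite rdotE; apply: normsq_le; first exact: H2_summable.
move=> L; apply: le_trans fN; apply: le_trans (ler_norm _).
rewrite -/(rdot f f) lerBrDr rdotE.
apply: le_trans (normsq_ub (N + L) (@H2_summable _ _ f)).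
rewrite /series /= [leRHS](big_cat_nat (n := N)) ?leq_addr //= [leLHS]addrC.
apply: lerD; first by apply: ler_sum => n _; rewrite Re_hdot.
have [LN|NL] := leqP L N.
  rewrite big_nat big1 ?sumr_ge0 // => [n _|n /andP[_ nL]].
    by rewrite Re_hdot hrdot_ge0.
  rewrite Re_hdot /hrdot big1_seq // => a /andP[_]; rewrite mem_mseq => /eqP an.
  by rewrite gN ?an ?(leq_trans nL) // /rprod /= !mul0r addr0 mulr0.
rewrite (big_cat_nat (n := N)) ?(ltnW NL) //= [X in X + _]big_nat big1 ?add0r.
  rewrite [leRHS](big_cat_nat (n := L)) ?(ltnW NL) ?leq_addl //=.
  apply: ler_wpDr; first by apply: sumr_ge0 => n _; rewrite Re_hdot hrdot_ge0.
  apply: ler_sum => n _; rewrite !Re_hdot; apply: ler_sum => a _.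
  rewrite ler_wpM2l ?(ltW (mweight_gt0 _ _)) // !rprodE.
  have : `|g a| ^+ 2 <= `|f a| ^+ 2 by rewrite lerXn2r ?nnegrE.
  by rewrite lecE => /andP[].
move=> n /andP[_ nN]; rewrite Re_hdot /hrdot big1_seq // => a /andP[_].
by rewrite mem_mseq => /eqP an; rewrite gN ?an // /rprod /= !mul0r addr0 mulr0.
Qed.

Lemma closed_hcomp K f : closed K -> linsub K ->
  (forall n, K (hcomp n f)) -> K f.
Proof.
move=> clK sK Kf; apply: closed_approx => // e e0.
have [N fN] := tail_small f e0.
exists (\sum_(n < N) hcomp n f); first exact: linsub_sum.
have sumE a : (\sum_(n < N) hcomp n f) a = if (mdeg a < N)%N then f a else 0.
  rewrite H2sumE; case: ifP => aN.
    rewrite (bigD1 (Ordinal aN)) // hcompE eqxx big1; first exact: addr0.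
    move=> n /eqP na.
    by rewrite hcompE; case: eqP => // an; case: na; apply: val_inj.
  by rewrite big1 // => n _; rewrite hcompE; case: eqP => // an;
    rewrite an ltn_ord in aN.
apply: fN => a; rewrite H2BE sumE; first by move=> ->; rewrite subrr.
by case: ifP => _; rewrite ?subr0 // subrr normr0.
Qed.

Lemma root_pow2_N1 J : exists2 l : C, `|l| = 1 & l ^+ (2 ^ J) = -1.
Proof.
have [l lJ] : exists l : C, l ^+ (2 ^ J) = -1.
  elim: J => [|J [l lJ]]; first by exists (-1).
  by exists (sqrtC l); rewrite expnS exprM sqrtCK.
exists l => //; apply/eqP; rewrite -(@pexpr_eq1 _ _ (2 ^ J)) ?expn_gt0 //.
by rewrite -normrX lJ normrN1.
Qed.

Lemma modn_double m p : (m %% (p * 2) = odd (m %/ p) * p + m %% p)%N.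
Proof.
have [->|p0] := posnP p; first by rewrite muln0 mul0n !modn0.
rewrite {1}(divn_eq m p) -{1}(odd_double_half (m %/ p)) -muln2 mulnDl.
rewrite -mulnA (mulnC 2) [X in (X + _)%N]addnC -addnA modnMDl modn_small //.
by have := ltn_pmod m p0; case: odd; lia.
Qed.

(** Finite averages replace the Fourier integral over the circle. To double the modulus, take l with
    l^(2^J) = -1: on degrees m congruent to n modulo 2^J, l^(m - n) is 1 or -1 according to the
    class of m modulo 2^(J+1), so averaging g with l^(-n) times its rotation kills the wrong
    class. *)
Lemma graded_residue K f n J : linsub K -> graded K -> K f ->
  K (hmask (fun a => mdeg a == n %[mod 2 ^ J]) f).
Proof.
move=> sK gK Kf; elim: J => [|J IH].
  by rewrite (_ : hmask _ f = f) //; apply: H2P => a; rewrite hmaskE !modn1.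
have [l l1 lJ] := root_pow2_N1 J; set g := hmask _ f in IH.
have l0 : l != 0 by rewrite -normr_eq0 l1 oner_eq0.
rewrite (_ : hmask _ f = (2^-1) *: (g + (l ^- n) *: @Defs.rot R d l l1 g)).
  by apply: linsubZ => //; apply: linsubD => //; apply: linsubZ; last exact: gK.
have powl m : l ^+ m = (-1) ^+ odd (m %/ 2 ^ J) * l ^+ (m %% 2 ^ J).
  by rewrite {1}(divn_eq m (2 ^ J)) exprD mulnC exprM lJ signr_odd.
apply: H2P => a; rewrite H2ZE H2DE H2ZE -[@Defs.rot R d l l1 g a]/(l ^+ mdeg a
  * g a).
rewrite /g !hmaskE; rewrite expnSr !modn_double.
case: (eqVneq (mdeg a %% 2 ^ J)%N (n %% 2 ^ J)%N) => [an|an]; last first.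
  rewrite !mulr0 addr0 mulr0 ifF //; apply/negbTE; apply: contra an => /eqP.
  move=> /(congr1 (modn^~ (2 ^ J)%N)); rewrite !modnMDl !modn_mod => ->.
  by rewrite eqxx.
rewrite an eqn_add2r eqn_pmul2r ?expn_gt0 // mulrA.
rewrite (powl (mdeg a)) (powl n) an invfM mulrACA mulVf ?expf_neq0 // mulr1.
by case: (odd (mdeg a %/ _)); case: (odd (n %/ _)); rewrite /=; field.
Qed.

Lemma graded_hcomp K f n : closed K -> linsub K -> graded K -> K f ->
  K (hcomp n f).
Proof.
move=> clK sK gK Kf; apply: closed_approx => // e e0.
(* 2^J exceeds both [N] and [n], so the degrees other than n that are congruent to n are at least
   2^J; what the mask keeps beyond [hcomp n f] lies in the tail past [N]. *)
have [N fN] := tail_small f e0; pose J := maxn N n.+1.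
exists (hmask (fun a => mdeg a == n %[mod 2 ^ J]) f);
  first exact: graded_residue.
have NJ : (N < 2 ^ J)%N by apply: leq_ltn_trans (leq_maxl _ _) (ltn_expl _ _).
have nJ : (n < 2 ^ J)%N.
  by apply: ltn_trans (leq_maxr N n.+1) (ltn_expl _ _).
apply: fN => a; rewrite H2BE !hmaskE.
  move=> aN; rewrite !modn_small ?(ltn_trans aN) // subrr //.
case: eqP => [->|_]; first by rewrite eqxx subrr normr0.
by case: ifP => _; rewrite ?subr0 ?sub0r ?normrN // normr0.
Qed.

End Grading.

(** * Products of homogeneous polynomials *)

Section HomogeneousProduct.
Local Open Scope complex_scope.
Variables (R : realType) (d : nat).
Local Notation C := R[i].
Local Notation M := (midx d).
Local Notation H := (H2 R d).
Implicit Types (f g h : H) (K : set H) (a b c : M).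

Definition mle a c := [forall i, (a i <= c i)%N].
Definition msub c a : M := [ffun i => (c i - a i)%N].

Lemma mleP a c : reflect (forall i, (a i <= c i)%N) (mle a c).
Proof. exact: forallP. Qed.

Lemma msubK c a : mle a c -> msub c (msub c a) = a.
Proof. by move=> /mleP ac; apply/ffunP => i; rewrite !ffunE subKn. Qed.

Lemma mle_msub c a : mle (msub c a) c.
Proof. by apply/mleP => i; rewrite ffunE leq_subr. Qed.

Lemma mdeg_msub c a : mle a c -> (mdeg a + mdeg (msub c a) = mdeg c)%N.
Proof.
move=> /mleP ac; rewrite /mdeg -big_split; apply: eq_bigr => i _.
by rewrite ffunE /= subnKC.
Qed.

Lemma leq_mdeg a i : (a i <= mdeg a)%N.
Proof. by rewrite /mdeg (bigD1 i) //= leq_addr. Qed.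

(** The multiple z^a f, obtained by induction on the degree of a. [V] is a mere set because the
    orthogonal family to which this is applied consists of homogeneous elements and need not be a
    subspace. *)
Lemma monomial_multiple (V : set H) a f :
  (forall k h, V h -> V (zmul k h)) -> V f ->
  exists2 h, V h & forall c, h c = if mle a c then f (msub c a) else 0.
Proof.
move=> Vz Vf; have [n] := ubnP (mdeg a); elim: n a => // n IH a an.
have [[k ak]|a0] := pselect (exists k, (0 < a k)%N); last first.
  exists f => // c; rewrite ifT; last first.
    apply/mleP => i; rewrite leqNgt; apply/negP => ci; case: a0; exists i.
    exact: leq_ltn_trans ci.
  congr (f _); apply/ffunP => i; rewrite ffunE.
  have -> : a i = 0%N by apply/eqP; rewrite -leqn0 leqNgt; apply/negP => ai;
    case: a0; exists i.
  by rewrite subn0.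
have [|h Vh hE] := IH (mdec k a).
  by rewrite -ltnS -(mdeg_minc k) mdecK // ltnS.
exists (zmul k h); first exact: Vz.
move=> c; rewrite zmulE; case: eqP => ck.
  by rewrite ifF //; apply/negP => /mleP/(_ k); rewrite ck leqn0 => /eqP a0;
    rewrite a0 in ak.
rewrite hE (_ : mle _ _ = mle a c); last first.
  apply/mleP/mleP => ac i; have := ac i; rewrite ?ffunE; case: eqP => [->|];
    lia.
case: ifP => // /mleP ac; congr (f _); apply/ffunP => i; have := ac i.
by rewrite !ffunE; case: eqP => [->|]; lia.
Qed.

(** Coefficients of the product g f, for [g] homogeneous of degree [n], written as a combination of
    monomial multiples of [f]. *)
Definition conv n (g f : H) c : C :=
  \sum_(a <- mseq d n) g a * (if mle a c then f (msub c a) else 0).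

(** The substitution a -> c - a exchanges the divisors of z^c of degrees n and m when |c| = n + m;
    otherwise both sides vanish. One product can thus be read as a multiple of either factor. *)
Lemma conv_sym m n f g c :
  homog m f -> homog n g -> conv n g f c = conv m f g c.
Proof.
move=> hf hg; have [cnm|cnm] := eqVneq (mdeg c) (n + m)%N; last first.
  rewrite /conv !big1_seq // => a /andP[_]; rewrite mem_mseq => /eqP an.
    case: ifP => [ac|_]; last by rewrite mulr0.
    rewrite hg ?mulr0 //; apply: contra cnm => /eqP cn.
    by rewrite -(mdeg_msub ac) cn an addnC.
  case: ifP => [ac|_]; last by rewrite mulr0.
  rewrite hf ?mulr0 //; apply: contra cnm => /eqP cn.
  by rewrite -(mdeg_msub ac) cn an.
have convE k (u v : H) :
    conv k u v c = \sum_(a <- [seq a :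
      M <- mseq d k | mle a c]) u a * v (msub c a).
  rewrite big_filter [RHS]big_mkcond; apply: eq_bigr => a _.
  by case: ifP => // _; rewrite mulr0.
have pms : perm_eq [seq a : M <- mseq d n | mle a c]
    (map (msub c) [seq a : M <- mseq d m | mle a c]).
  apply: uniq_perm; first by rewrite filter_uniq ?mseq_uniq.
    rewrite map_inj_in_uniq ?filter_uniq ?mseq_uniq // => a b.
    rewrite !mem_filter => /andP[ac _] /andP[bc _] ab.
    by rewrite -(msubK ac) ab msubK.
  move=> a; rewrite mem_filter mem_mseq; apply/andP/mapP => [[ac /eqP an]|[b]].
    exists (msub c a); last by rewrite msubK.
    rewrite mem_filter mle_msub mem_mseq /=.
    by move: (mdeg_msub ac); rewrite cnm an => /addnI ->.
  rewrite mem_filter mem_mseq => /andP[bc /eqP bm] ->.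
  rewrite mle_msub; split=> //.
  by move: (mdeg_msub bc); rewrite cnm bm addnC => /addIn ->.
rewrite !convE (perm_big _ pms) big_map [LHS]big_seq [RHS]big_seq.
apply: eq_bigr => a; rewrite mem_filter => /andP[ac _].
by rewrite msubK // mulrC.
Qed.

(* Kronecker substitution: an additive weight separating the multi-indices with
   entries < B. *)
Definition kweight B a : nat := (\sum_i a i * B ^ i)%N.

Lemma digits_inj B m (a b : 'I_m -> nat) :
  (forall i, (a i < B)%N) -> (forall i, (b i < B)%N) ->
  (\sum_i a i * B ^ i = \sum_i b i * B ^ i)%N -> a =1 b.
Proof.
elim: m a b => [|m IH] a b aB bB; first by move=> _ [].
have E (x : 'I_m.+1 -> nat) : (\sum_i x i * B ^ i =
    (\sum_(i < m) x (lift ord0 i) * B ^ i) * B + x ord0)%N.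
  rewrite big_ord_recl expn0 muln1 addnC big_distrl; congr (_ + _)%N.
  by apply: eq_bigr => i _; rewrite /= expnSr mulnA.
rewrite !E => ab; have B0 : (0 < B)%N by apply: leq_ltn_trans (aB ord0).
have ab0 : a ord0 = b ord0.
  by have := congr1 (modn^~ B) ab; rewrite /= !modnMDl !modn_small.
move: ab; rewrite ab0 => /addIn/eqP; rewrite eqn_pmul2r // => /eqP.
move=> /(IH _ _ (fun i => aB _) (fun i => bB _)) abS i.
by case: (unliftP ord0 i) => [j|] ->.
Qed.

Lemma kweight_inj B a b :
  (mdeg a < B)%N -> (mdeg b < B)%N -> kweight B a = kweight B b -> a = b.
Proof.
move=> aB bB ab; apply/ffunP; apply: digits_inj ab => i.
  exact: leq_ltn_trans (leq_mdeg a i) aB.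
exact: leq_ltn_trans (leq_mdeg b i) bB.
Qed.

Lemma leading_index B n f : homog n f -> f <> 0 ->
  exists2 a, f a != 0 & forall b, f b != 0 -> (kweight B b <= kweight B a)%N.
Proof.
move=> hf f0.
have mem a : f a != 0 -> a \in mseq d n.
  by rewrite mem_mseq; apply: contraR => /hf/eqP.
pose P k := has (fun a : M => (f a != 0) && (kweight B a == k)) (mseq d n).
have exP : exists k, P k.
  have [[a fa]|fa] := pselect (exists a, f a != 0).
    by exists (kweight B a); apply/hasP; exists a; rewrite ?mem // fa eqxx.
  case: f0; apply: H2P => a; apply/eqP/negPn/negP => a0.
  by case: fa; exists a.
have ubP k : P k -> (k <= \sum_(a <- mseq d n) kweight B a)%N.
  by move=> /hasP[a am /andP[_ /eqP <-]]; rewrite (big_rem _ am) leq_addr.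
case: (ex_maxnP exP ubP) => k /hasP[a am /andP[fa /eqP <-]] kmax.
exists a => // b fb; apply: kmax; apply/hasP.
by exists b; rewrite ?mem // fb eqxx.
Qed.

Lemma conv_neq0 m n f g : homog m f -> homog n g -> f <> 0 -> g <> 0 ->
  exists c, conv n g f c != 0.
Proof.
(* [B] exceeds the degrees of the indices to be compared, hence their entries, so [kweight B]
   separates them. *)
move=> hf hg f0 g0; pose B := (m + n).+1.
have [a ga amax] := leading_index B hg g0.
have [b fb bmax] := leading_index B hf f0.
have deg_f c : f c != 0 -> mdeg c = m by apply: contraNeq => /hf ->.
have deg_g c : g c != 0 -> mdeg c = n by apply: contraNeq => /hg ->.
pose c : M := [ffun i => (a i + b i)%N].
have ac : mle a c by apply/mleP => i; rewrite ffunE leq_addr.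
have cab : msub c a = b by apply/ffunP => i; rewrite !ffunE addKn.
have am : a \in mseq d n by rewrite mem_mseq (deg_g a).
exists c; rewrite /conv (bigD1_seq a) ?mseq_uniq //= ac cab big1.
  by rewrite addr0 mulf_neq0.
move=> a' a'a; apply/eqP; case: ifP => [a'c|_]; last by rewrite mulr0.
rewrite mulf_eq0 -[_ || _]negbK negb_or; apply/negP => /andP[ga' fa'].
case/eqP: a'a; apply: (@kweight_inj B).
- by rewrite (deg_g _ ga') /B ltnS leq_addl.
- by rewrite (deg_g _ ga) /B ltnS leq_addl.
(* Both decompositions of c have the same total weight, and neither summand can exceed its maximum;
   hence equality in each. *)
have kD : (kweight B a' + kweight B (msub c a') = kweight B a + kweight B b)%N.
  rewrite /kweight -!big_split; apply: eq_bigr => i _ /=.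
  rewrite -!mulnDl; congr (_ * _)%N.
  by have /mleP/(_ i) := a'c; rewrite !ffunE; lia.
by have := amax _ ga'; have := bmax _ fa'; lia.
Qed.

(* The product of the polynomials f and g lies in both modules. *)
Lemma orthogonal_modules K (N : set H) m n f g : linsub K ->
  (forall k h, K h -> K (zmul k h)) -> (forall k h, N h -> N (zmul k h)) ->
  (forall h u, N h -> K u -> rdot h u = 0) ->
  K f -> homog m f -> f <> 0 -> N g -> homog n g -> g = 0.
Proof.
move=> sK Kz Nz NK Kf hf f0 Ng hg; have [//|/eqP g0] := eqVneq g 0; exfalso.
have [c] := conv_neq0 hf hg f0 g0; apply/negP/negPn/eqP.
have /choice[F FP] a : exists h, K h /\
    forall c, h c = if mle a c then f (msub c a) else 0.
  by have [h ? ?] := monomial_multiple a Kz Kf; exists h.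
have /choice[G GP] a : exists h, N h /\
    forall c, h c = if mle a c then g (msub c a) else 0.
  by have [h ? ?] := monomial_multiple a Nz Ng; exists h.
pose p : H := \sum_(a <- mseq d n) g a *: F a.
have pE e : p e = conv n g f e.
  by rewrite H2sumE; apply: eq_bigr => a _; rewrite H2ZE (FP a).2.
have Kp : K p by apply: linsub_sum => // a _; apply: linsubZ => //;
  case: (FP a).
(* The same product as a combination of multiples of [g], each orthogonal to [K]; pairing it
   termwise with p in K gives <p, p> = 0. *)
have pq : p = \sum_(b <- mseq d m) f b *: G b.
  apply: H2P => e; rewrite pE (conv_sym _ hf hg) H2sumE.
  by apply: eq_bigr => b _; rewrite H2ZE (GP b).2.
suff p0 : p = 0 by rewrite -pE p0.
apply: rdot_eq0; rewrite {1}pq rdot_suml big1 // => b _.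
by rewrite rdotZJ (NK _ _ (GP b).1) //; exact: linsubZ.
Qed.

End HomogeneousProduct.

(** * The compressed operators on a graded submodule, and its rank *)

Section GradedSubmodule.
Local Open Scope complex_scope.
Variables (R : realType) (d : nat) (K : set (H2 R d)).
Local Notation C := R[i].
Local Notation M := (midx d).
Local Notation H := (H2 R d).
Implicit Types (f g h u : H).
Hypotheses (K_submodule : closed_submodule K) (K_graded : graded K).

Let clK : closed K. Proof. by case: K_submodule. Qed.

Let sK : linsub K. Proof. by case: K_submodule. Qed.

Lemma submodule_zmul k h : K h -> K (zmul k h).
Proof. by case: K_submodule => _ _; apply. Qed.

(** The candidate for T_k^*, extended to all of H^2. *)
Definition cadj k f : H := oproj K (zadj k f).

Lemma cadj_linear k : linear_op (cadj k).
Proof. by move=> c f g; rewrite /cadj zadj_linear oproj_linear. Qed.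

Lemma rdot_cadj k f g : K f -> rdot f (cadj k g) = rdot (zmul k f) g.
Proof. by move=> Kf; rewrite rdotC (rdot_oproj clK sK _ Kf) rdotC zmul_adj. Qed.

Lemma rnorm_zadj k f : rnorm (zadj k f) <= rnorm f.
Proof.
apply: rnorm_le; first exact: rnorm_ge0.
rewrite sqr_rnorm; apply: le_trans (sum_zadj_le f).
by rewrite (bigD1 k) //= lerDl sumr_ge0 // => i _; exact: rdot_ge0.
Qed.

Lemma rnorm_cadj k f : rnorm (cadj k f) <= rnorm f.
Proof.
apply: le_trans (rnorm_zadj k f); apply: rnorm_le; first exact: rnorm_ge0.
by rewrite sqr_rnorm oproj_contraction.
Qed.

Lemma is_adjoint_cadj k : is_adjoint K (zmul k) (cadj k).
Proof.
split; first split.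
- by move=> f _; exact: oproj_in.
- by move=> c f g _ _; exact: cadj_linear.
- exists 1 => f _; rewrite mul1r !normE lecR; exact: rnorm_cadj.
move=> f g Kf Kg; rewrite !dotE; congr (_ +i* _).
  by rewrite rdot_cadj.
by rewrite -(linear_opZ (cadj_linear k)) rdot_cadj.
Qed.

(** [adjoint] is a choice determined on [K] only: the difference of the two candidates at [g] lies
    in [K], and testing it against itself gives zero. *)
Lemma adjointE k g : K g -> adjoint K (zmul k) g = cadj k g.
Proof.
move=> Kg; have [[KT _ _] adjT] : is_adjoint K (zmul k) (adjoint K (zmul k)).
  exact: (xgetPex _ (ex_intro _ _ (is_adjoint_cadj k))).
apply/eqP; rewrite -subr_eq0; apply/eqP/rdot_eq0; set h := _ - _.
have Kh : K h by apply: linsubB => //; [exact: KT|exact: oproj_in].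
rewrite {2}/h rdotBr rdot_cadj //.
by have := adjT h g Kh Kg; rewrite !dotE => -[-> _]; rewrite subrr.
Qed.

(** The sum of the T_k T_k^* as an operator on all of H^2, where it is a self-adjoint contraction
    and [exists_sqrt] applies. *)
Definition row_op f : H := \sum_k zmul k (cadj k f).

Lemma row_op_linear : linear_op row_op.
Proof.
move=> c f g; rewrite /row_op scaler_sumr -big_split; apply: eq_bigr => k _.
by rewrite cadj_linear zmul_linear.
Qed.

Lemma rdot_row_op f g : rdot (row_op f) g = \sum_k rdot (cadj k f) (cadj k g).
Proof.
rewrite rdot_suml; apply: eq_bigr => k _.
by rewrite rdot_cadj //; exact: oproj_in.
Qed.

Lemma row_op_selfadj f g : rdot (row_op f) g = rdot f (row_op g).
Proof.
rewrite [RHS]rdotC [LHS]rdot_row_op [RHS]rdot_row_op.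
by apply: eq_bigr => k _; exact: rdotC.
Qed.

Lemma row_op_contraction f : rnorm (row_op f) <= rnorm f.
Proof.
apply: rnorm_le; first exact: rnorm_ge0.
rewrite sqr_rnorm; apply: le_trans (rdot_sum_zmul_le _) _.
apply: le_trans (sum_zadj_le f); apply: ler_sum => k _.
exact: oproj_contraction.
Qed.

Lemma row_op_in f : K (row_op f).
Proof.
by apply: linsub_sum => // k _; apply: submodule_zmul; exact: oproj_in.
Qed.

Lemma defectP : is_sqrt K (fun f => f - row_op f) (defect K).
Proof.
pose S f := f - \sum_k zmul k (adjoint K (zmul k) f).
have SE f : K f -> S f = f - row_op f.
  by move=> Kf; congr (_ - _); apply: eq_bigr => k _; rewrite adjointE.
suff [D DP] : exists D, is_sqrt K S D.
  have [DK D0 DD] : is_sqrt K S (defect K) := xgetPex _ (ex_intro _ _ DP).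
  by split=> // f Kf; rewrite DD // SE.
have [D [linD selfD normD D0 [DD DK]]] :=
  exists_sqrt row_op_linear row_op_selfadj row_op_contraction.
exists D; split.
- split; first by move=> f; apply: DK => // g _; exact: row_op_in.
    by move=> c f g _ _; exact: linD.
  by exists (2 : R)%:C => f _; rewrite !normE -rmorphM lecR.
- move=> f _; rewrite dotE lecE /= D0 andbT; apply/eqP.
  (* This is the imaginary part of <D f, f>; self-adjointness and the conjugate of i being -i make
     it its own negative. *)
  have : rdot (D f) ('i *: f) = - rdot (D f) ('i *: f).
    have iE : ('i : C)^* *: f = - ('i *: f).
      by rewrite -scaleNr; congr (_ *: f); apply/eqP;
        rewrite eq_complex /= oppr0 !eqxx.
    by rewrite [LHS]selfD (linear_opZ linD) [LHS]rdotC [LHS]rdotZJ iE rdotNr.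
  by move/eqP; rewrite -addr_eq0 -mulr2n mulrn_eq0 => /eqP.
- by move=> f Kf; rewrite DD SE.
Qed.

(** Components of P f stay in [K] by grading, so for m other than n, |(P f)_m|^2 = <P f, (P f)_m> =
    <f, (P f)_m> = 0. *)
Lemma homog_oproj n f : homog n f -> homog n (oproj K f).
Proof.
move=> hf a an; have hcK m : K (hcomp m (oproj K f)).
  by apply: graded_hcomp => //; exact: oproj_in.
suff h0 : hcomp (mdeg a) (oproj K f) = 0.
  by have := congr1 (fun g : H => g a) h0; rewrite hcompE eqxx.
apply: rdot_eq0; rewrite rdot_hcomp.
rewrite (rdot_oproj clK sK _ (hcK _)) (rdot_homog _ hf).
rewrite (_ : hcomp n _ = 0) ?rdot0r //.
by apply: (hcomp_neq (homog_hcomp _)); rewrite eq_sym.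
Qed.

Lemma homog_row_op n f : homog n f -> homog n (row_op f).
Proof.
(* Degree 0 is separate: every z_k^* kills the constants. *)
case: n => [|n] hf a an; rewrite H2sumE big1 // => k _.
  rewrite zmulE; case: ifP => // _; rewrite /cadj.
  suff -> : zadj k f = 0 by rewrite oproj_id //; case: sK.
  by apply: H2P => b; rewrite zadjE hf ?mulr0 // mdeg_minc.
apply: homog_zmul an; apply: homog_oproj; exact: homog_zadj.
Qed.

Lemma zadj_in n u : homog n.+1 u -> row_op u = u -> forall k, K (zadj k u).
Proof.
move=> hu Au; have sumE : \sum_k (rdot (zadj k u) (zadj k u) -
    rdot (cadj k u) (cadj k u)) = 0.
  rewrite sumrB sum_rdot_zadj (sum_zmul_zadj_homog hu) -rdot_row_op Au.
  by rewrite subrr.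
move=> k; have := oproj_pythagoras clK sK (zadj k u); rewrite -/(cadj k u) => e.
suff q0 : rdot (zadj k u - cadj k u) (zadj k u - cadj k u) = 0.
  move/rdot_eq0/eqP: q0; rewrite subr_eq0 => /eqP ->; exact: oproj_in.
have ge0 i : 0 <= rdot (zadj i u) (zadj i u) - rdot (cadj i u) (cadj i u).
  by rewrite subr_ge0 oproj_contraction.
(* Each summand is the squared distance from z_i^* u to [K], and they sum to zero. *)
have /psumr_eq0P/(_ sumE k isT) := fun i (_ : true) => ge0 i.
by rewrite e addrAC subrr add0r.
Qed.

Lemma orth_zmul n0 : (forall n u, (n0 <= n)%N -> K u -> homog n u -> row_op u =
  u) ->
  forall n k g, (n0 <= n)%N -> homog n g -> (forall u, K u -> rdot g u = 0) ->
  forall u, K u -> rdot (zmul k g) u = 0.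
Proof.
move=> Kn0 n k g n0n hg gK u Ku.
(* Only the component of [u] in degree n + 1 pairs with z_k g, and z_k^* sends that component into
   [K]. *)
rewrite (rdot_homog _ (homog_zmul k hg)) zmul_adj; apply: gK.
have hu : homog n.+1 (hcomp n.+1 u) by exact: homog_hcomp.
apply: (zadj_in hu); apply: (Kn0 n.+1) => //; first exact: leqW.
exact: graded_hcomp.
Qed.

(** More vectors than there are monomials of degree below n0 have a nontrivial combination without
    low-degree coefficients; such an element lies in [K], which is closed. *)
Lemma codim_fin n0 : (forall n f, (n0 <= n)%N -> homog n f -> K f) ->
  codim K <> +oo%E.
Proof.
move=> Kn0; pose s := flatten [seq mseq d n | n <- iota 0 n0].
have ms a : (a \in s) = (mdeg a < n0)%N.
  apply/flatten_mapP/idP => [[n]|an].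
    by rewrite mem_iota add0n mem_mseq => nn0 /eqP ->.
  by exists (mdeg a); rewrite ?mem_iota ?mem_mseq.
suff cd : (codim K <= (size s)%:R%:E)%E.
  by move=> e; move: cd; rewrite e leye_eq.
apply: ge_ereal_sup => _ [m [v [_ vK]] <-]; rewrite lee_fin ler_nat leqNgt.
apply/negP => sm.
(* Row i holds the low-degree coefficients of [v i]; a nonzero row vector in the left kernel is the
   combination sought. *)
pose V : 'M[C]_(m, size s) := \matrix_(i, j) v i (nth [ffun=> 0%N] s j).
have : kermx V != 0.
  rewrite -mxrank_eq0 mxrank_ker subn_eq0 -ltnNge.
  exact: leq_ltn_trans (rank_leq_col _) sm.
case/rowV0Pn => x xV /negP[]; apply/eqP/rowP => i.
rewrite mxE; apply: (vK (x 0)).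
move/sub_kermxP: xV => xV.
apply: closed_hcomp => // n; have [n0n|nn0] := leqP n0 n.
  exact: Kn0 n0n (homog_hcomp _).
suff -> : hcomp n (\sum_j x 0 j *: v j) = 0 by case: sK.
apply: H2P => a; rewrite hcompE; case: eqP => // an.
have as_ : a \in s by rewrite ms an.
have as' : (index a s < size s)%N by rewrite index_mem.
have := congr1 (fun y : 'rV_(size s) => y 0 (Ordinal as')) xV.
rewrite mxE [RHS]mxE => e; rewrite H2sumE -[RHS]e; apply: eq_bigr => j _.
by rewrite mxE /= nth_index.
Qed.

Lemma defect_unbounded : K <> [set 0] -> codim K = +oo%E ->
  forall n0, exists n f, [/\ (n0 <= n)%N, K f, homog n f & f - row_op f <> 0].
Proof.
move=> K0 cK n0; apply: contrapT => noex.
have Kn0 n u : (n0 <= n)%N -> K u -> homog n u -> row_op u = u.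
  move=> n0n Ku hu; apply/eqP/negPn/negP => /eqP ne; apply: noex.
  exists n, u; split=> // /eqP; rewrite subr_eq0 => /eqP e; exact: ne.
(* Some homogeneous component of a nonzero element is nonzero, and it lies in [K] by grading. *)
have [m [f [Kf hf f0]]] : exists m f, [/\ K f, homog m f & f <> 0].
  apply: contrapT => no; apply: K0; apply/seteqP; split=> f; last first.
    by move=> ->; case: sK.
  move=> Kf; apply: H2P => a.
  suff e : hcomp (mdeg a) f = 0.
    by have := congr1 (fun g : H => g a) e; rewrite hcompE eqxx.
  apply/eqP/negPn/negP => /eqP ne; apply: no;
    exists (mdeg a), (hcomp (mdeg a) f).
  by split=> //; [exact: graded_hcomp|exact: homog_hcomp].
apply: (@codim_fin n0) cK => n h n0n hh.
pose N := [set g | (exists2 n, (n0 <= n)%N & homog n g) /\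
                   forall u, K u -> rdot g u = 0].
suff : h - oproj K h = 0.
  by move/eqP; rewrite subr_eq0 => /eqP ->; exact: oproj_in.
have hhP : homog n (h - oproj K h).
  by move=> a an; rewrite H2BE hh // (homog_oproj hh) // subrr.
apply: (@orthogonal_modules _ _ K N m n f) => //.
- exact: submodule_zmul.
- move=> k g [[l n0l hg] gK]; split; last exact: (orth_zmul Kn0 k n0l hg gK).
  by exists l.+1; [exact: leqW|exact: homog_zmul].
- by move=> g u [_]; exact.
- by split; [exists n|move=> u; exact: oproj_orth].
Qed.

(** Delta itself is not shown to preserve degrees. Applying it once more to a relation among the
    Delta w_i gives one among the S w_i, which are nonzero and homogeneous of distinct degrees. *)
Lemma rank_infinite :
  (forall n0, exists n f, [/\ (n0 <=
    n)%N, K f, homog n f & f - row_op f <> 0]) ->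
  rank K = +oo%E.
Proof.
move=> /choice[deg /choice[F FP]].
(* Each new vector is requested beyond the previous degree, so the degrees [e] increase strictly. *)
pose e := fix e i := if i is j.+1 then deg (e j).+1 else deg 0%N.
pose w i := if i is j.+1 then F (e j).+1 else F 0%N.
have wP i : [/\ K (w i), homog (e i) (w i) & w i - row_op (w i) <> 0].
  by case: i => [|i] /=; [case: (FP 0%N)|case: (FP (e i).+1)].
have eS i : (e i < e i.+1)%N by case: (FP (e i).+1).
have e_inj : injective e.
  have lt i j : (i < j)%N -> (e i < e j)%N.
    by apply: (homo_ltn ltn_trans) => ?; exact: eS.
  move=> i j eij; case: (ltngtP i j) => // /lt; rewrite eij ltnn //.
have [[DK Dl _] _ DD] := defectP.
have D0 : defect K 0 = 0.
  have K0 : K 0 by case: sK.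
  have := Dl 1 0 0 K0 K0; rewrite !scale1r addr0 => /eqP.
  by rewrite -[X in X == _]addr0 (inj_eq (addrI _)) eq_sym => /eqP.
have Dsum m (c : 'I_m -> C) (v : 'I_m -> H) : (forall i, K (v i)) ->
    defect K (\sum_i c i *: v i) = \sum_i c i *: defect K (v i).
  move=> Kv; suff [] : K (\sum_i c i *: v i) /\
    defect K (\sum_i c i *: v i) = \sum_i c i *: defect K (v i) by [].
  elim/big_rec2: _ => [|i x y _ [Kx <-]]; first by split; [case: sK|].
  by split; [apply: linsubD => //; exact: linsubZ|exact: Dl].
have wK i : K (w i) by case: (wP i).
have lower m : (m%:R%:E <= rank K)%E.
  apply: ereal_sup_ubound; exists m => //.
  exists (fun i : 'I_m => defect K (w i)); split.
    by move=> i; apply: subset_closure; exists (w i).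
  move=> c /(congr1 (defect K));
    rewrite D0 (Dsum _ c (fun i => defect K (w i))).
    under eq_bigr do rewrite DD //.
    move=> c0 i; have hS j : homog (e j) (w j - row_op (w j)).
      by case: (wP j) => _ hw _ a ae;
        rewrite H2BE hw // (homog_row_op hw) // subrr.
    have := congr1 (hcomp (e i)) c0.
    rewrite (_ : hcomp _ (\sum_j _) = c i *: (w i - row_op (w i))).
      rewrite (linear_op0 (@hcomp_linear _ _ _)) => /eqP.
      by rewrite scaler_eq0 => /orP[/eqP //|/eqP]; case: (wP i).
    apply: H2P => a; rewrite hcompE; case: eqP => [ai|/eqP ai].
      rewrite H2sumE (bigD1 i) // big1; first exact: addr0.
      move=> j ji; rewrite H2ZE hS ?mulr0 // ai; apply: contra ji => /eqP.
      by move=> /e_inj/val_inj ->.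
    by rewrite H2ZE hS ?mulr0.
  by move=> i; exact: DK.
move: lower; case: (rank K) => [r| |] lower //; last by have := lower 0%N.
have := lower (Num.trunc r).+1; rewrite lee_fin leNgt truncnS_gt //.
Qed.

End GradedSubmodule.
Theorem mainTheorem7 (R : realType) (d : nat) (d_ge1 : (1 <= d)%N)
    (K : set (H2 R d)) (K_submodule : closed_submodule K) (K_graded : graded K)
    (K_neq0 : K <> [set 0]) (K_codim : codim K = +oo%E) :
  rank K = +oo%E.
Proof. exact/rank_infinite/defect_unbounded. Qed.
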